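(* Let $\{A,B\}\subseteq\mathbb{S}^n$. If $\{A,B\}$ is singular, then it is ASDC.
   Context: $\mathbb{S}^n$ denotes the real vector space of $n\times n$ real symmetric matrices. A set $\mathcal{A}\subseteq\mathbb{S}^n$ is nonsingular if there exists a nonsingular (invertible) matrix in the linear span $\operatorname{span}(\mathcal{A})$; otherwise it is singular. A set $\mathcal{A}\subseteq\mathbb{S}^n$ is simultaneously diagonalizable via congruence (SDC) if there exists an invertible $P\in\mathbb{R}^{n\times n}$ such that $P^\top A P$ is diagonal for all $A\in\mathcal{A}$. A set $\mathcal{A}\subseteq\mathbb{S}^n$ is almost simultaneously diagonalizable via congruence (ASDC) if there exist sequences $A_i\to A$ in $\mathbb{S}^n$, one for every $A\in\mathcal{A}$, such that for every $i\in\mathbb{N}$ the set $\{A_i : A\in\mathcal{A}\}$ is SDC. *)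

(* Defs.v *)
From mathcomp Require Import all_boot all_order all_algebra.
From mathcomp Require Import all_classical all_reals all_analysis.

Set Implicit Arguments.
Unset Strict Implicit.
Unset Printing Implicit Defensive.

Import Order.TTheory GRing.Theory Num.Theory.
Import numFieldNormedType.Exports.

Local Open Scope classical_set_scope.
Local Open Scope ring_scope.

Definition sym_mx (R : realType) (n : nat) : set 'M[R]_n :=
  [set A | A \is symmetricmx].

(* [span] is only available for finite sequences, so the span of a possibly
   infinite set is the union of the spans of the finite sequences in it. *)
Definition lin_span (R : realType) (n : nat) (S : set 'M[R]_n) : set 'M[R]_n :=
  [set M | exists2 s : seq 'M[R]_n, [set` s] `<=` S & M \in span s].

Definition nonsingular_set (R : realType) (n : nat) (S : set 'M[R]_n) : Prop :=
  exists2 M, lin_span S M & M \in unitmx.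

Definition singular_set (R : realType) (n : nat) (S : set 'M[R]_n) : Prop :=
  ~ nonsingular_set S.

Definition SDC (R : realType) (n : nat) (S : set 'M[R]_n) : Prop :=
  exists2 P : 'M[R]_n, P \in unitmx &
    forall A, S A -> is_diag_mx (P^T *m A *m P).

(* The sequence attached to A in S is [F A]; the values of [F] outside S are
   irrelevant. Convergence is entrywise, i.e. in the usual topology of the
   finite-dimensional space of matrices. *)
Definition ASDC (R : realType) (n : nat) (S : set 'M[R]_n) : Prop :=
  exists F : 'M[R]_n -> nat -> 'M[R]_n,
    [/\ forall A, S A -> forall i, sym_mx (F A i),
        forall A, S A -> F A i @[i --> \oo] --> A
      & forall i, SDC [set F A i | A in S]].

(* [symmetricmx] is an instance of a general notion of sesquilinear form. *)
Lemma sym_mxE (R : realType) (n : nat) (A : 'M[R]_n) : sym_mx A <-> A^T = A.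
Proof.
rewrite /sym_mx /= qualifE /= expr0 scale1r map_mx_id //.
by split=> [/eqP|->].
Qed.

(* Main.v *)
Require Import Defs.
From mathcomp Require Import all_boot all_order all_algebra.
From mathcomp Require Import all_classical all_reals all_analysis.
From mathcomp Require Import perm separable complex polyrcf.
From mathcomp Require Import ring lra zify.

(** The pair (A, B) is studied through its pencil 'X A + B, a matrix of linear
    polynomials. When A is invertible and det ('X A + B) has n distinct real
    roots, the kernel vectors at these roots diagonalize A and B at once
    [distinct_roots_SDC]; since simple real roots are detected by sign changes,
    this persists under small symmetric perturbations [distinct_roots_persist].
    A pair is a limit of SDC pairs as soon as it is a limit of such limits
    [near_SDC_path], so it is enough to connect a singular pair to pencils with
    distinct real roots by one-parameter families.

    A singular pair has an identically vanishing determinant, hence a kernel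
    vector v_0 + v_1 'X + ... + v_k 'X^k with polynomial entries. For k minimal,
    a count of unknowns shows that v_0, ..., v_k are independent, and so are
    v_0 A, ..., v_(k-1) A [minimal_chain]; moreover the v_i span a subspace that
    is isotropic for A and for B. In a basis adapted to (v_1 .. v_k), vectors
    dual to the v_i A, v_0, and m further vectors, the pencil consists of one
    bidiagonal block, blocks A1 and C that are out of control, and an m x m
    pencil N [singular_pencil_form].

    Congruence by diag (t, 1/t, t, 1) multiplies the zero block of this form by
    t^2 and its border by t. Read backwards, a perturbation of size t^2 of the
    zero block and of size t of its border becomes a perturbation of size 1,
    while A1 and C are multiplied by t^2 and t and disappear in the limit. The
    limit has determinant +-(e c - f adj(N) f^T), where c = det N and both the
    polynomial e of degree at most 2k+1 and the real row f are free [det_nf].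
    It remains to prescribe this polynomial, that is, to prescribe the residue
    of f adj(N) f^T modulo c.

    To do so, N is moved along a line until c is separable of degree m
    [generic_line]. Then N splits into 1 x 1 blocks, one for each real root of
    c, and 2 x 2 blocks, one for each pair of conjugate roots. On a 2 x 2 block
    every residue is attained, because complex numbers have square roots; on a
    1 x 1 block the sign of the residue is constrained, so the value 0 is taken
    there and the real root is kept as a root of the target polynomial
    [realisable_generic]. The other roots of the target are then chosen real
    and distinct at will [nf_distinct_roots]. *)

Set Implicit Arguments.
Unset Strict Implicit.
Unset Printing Implicit Defensive.

Import Order.TTheory GRing.Theory Num.Theory.
Import numFieldNormedType.Exports.

Local Open Scope classical_set_scope.
Local Open Scope ring_scope.

(** * Linear matrix pencils *)

Section Pencil.
Variable K : comNzRingType.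

Definition pencil m n (A B : 'M[K]_(m, n)) : 'M[{poly K}]_(m, n) :=
  'X *: map_mx polyC A + map_mx polyC B.

Lemma pencilE m n (A B : 'M[K]_(m, n)) i j :
  pencil A B i j = (A i j)%:P * 'X + (B i j)%:P.
Proof. by rewrite !mxE mulrC. Qed.

Lemma pencil_horner m n (A B : 'M[K]_(m, n)) x :
  map_mx (horner_eval x) (pencil A B) = x *: A + B.
Proof. by apply/matrixP=> i j; rewrite mxE pencilE /horner_eval !hornerE !mxE mulrC. Qed.

Lemma det_pencil_horner n (A B : 'M[K]_n) x :
  (\det (pencil A B)).[x] = \det (x *: A + B).
Proof. by rewrite -[LHS]/(horner_eval x _) -det_map_mx pencil_horner. Qed.

Lemma pencil0 m n : pencil (0 : 'M[K]_(m, n)) 0 = 0.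
Proof. by rewrite /pencil map_mx0 scaler0 addr0. Qed.

Lemma tr_pencil m n (A B : 'M[K]_(m, n)) : (pencil A B)^T = pencil A^T B^T.
Proof. by apply/matrixP=> i j; rewrite !mxE. Qed.

Lemma pencil_congr m n (Q : 'M[K]_(m, n)) (A B : 'M[K]_n) :
  pencil (Q *m A *m Q^T) (Q *m B *m Q^T) =
  map_mx polyC Q *m pencil A B *m (map_mx polyC Q)^T.
Proof.
by rewrite /pencil mulmxDr mulmxDl -scalemxAr -scalemxAl !map_mxM -!map_trmx.
Qed.

Lemma pencil_block m1 m2 n1 n2 (A11 B11 : 'M[K]_(m1, n1)) A12 B12 A21 B21
    (A22 B22 : 'M[K]_(m2, n2)) :
  pencil (block_mx A11 A12 A21 A22) (block_mx B11 B12 B21 B22) =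
  block_mx (pencil A11 B11) (pencil A12 B12) (pencil A21 B21) (pencil A22 B22).
Proof. by rewrite /pencil !map_block_mx scale_block_mx add_block_mx. Qed.

Lemma size_pencil m n (A B : 'M[K]_(m, n)) i j : (size (pencil A B i j) <= 2)%N.
Proof.
rewrite pencilE (leq_trans (size_polyD _ _)) // geq_max.
rewrite (leq_trans (size_polyC_leq1 _)) // andbT mul_polyC.
by rewrite (leq_trans (size_scale_leq _ _)) ?size_polyX.
Qed.

Lemma size_det_le n (M : 'M[{poly K}]_n) :
  (forall i j, size (M i j) <= 2)%N -> (size (\det M) <= n.+1)%N.
Proof.
elim: n M => [|n IH] M szM; first by rewrite det_mx00 size_poly1.
rewrite (expand_det_row _ ord0); apply: (leq_trans (size_sum _ _ _)).
apply/bigmax_leqP => j _; rewrite /cofactor.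
have szd : (size (\det (row' ord0 (col' j M))) <= n.+1)%N.
  by apply: IH => i k; rewrite !mxE.
rewrite mulrCA -signr_odd; have -> (b : bool) (p : {poly K}) :
  size ((-1) ^+ b * p) = size p by case: b; rewrite ?mulN1r ?mul1r ?size_polyN.
apply: (leq_trans (size_polyMleq _ _)); have := szM ord0 j.
move: szd; set u := size _; set v := size _; lia.
Qed.

Lemma size_adj_pencil n (A B : 'M[K]_n) i j :
  (size (\adj (pencil A B) i j) <= n)%N.
Proof.
case: n A B i j => [|n] A B i j; first by case: i.
rewrite mxE /cofactor.
set d := \det _; have szd : (size d <= n.+1)%N.
  by apply: size_det_le => k l; rewrite [row' _ _ _ _]mxE [col' _ _ _ _]mxE size_pencil.
by rewrite -signr_odd; case: odd; rewrite ?mulN1r ?mul1r ?size_polyN.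
Qed.

(** Each term of the Leibniz expansion of the determinant of a pencil is a
    product of this shape. *)
Lemma prod_linear n (a b : 'I_n -> K) (p := \prod_(i < n) ((a i)%:P * 'X + (b i)%:P)) :
  (size p <= n.+1)%N /\ p`_n = \prod_(i < n) a i.
Proof.
rewrite {}/p; elim: n a b => [|n IH] a b.
  by rewrite !big_ord0 size_poly1 coef1.
rewrite !big_ord_recl /=; have [] := IH (a \o lift ord0) (b \o lift ord0).
rewrite /=; set p := \prod_(_ < n) _ => szp pn; split.
  apply: (leq_trans (size_polyMleq _ _)).
  have : (size ((a ord0)%:P * 'X + (b ord0)%:P)%R <= 2)%N.
    rewrite (leq_trans (size_polyD _ _)) // geq_max.
    rewrite (leq_trans (size_polyC_leq1 _)) // andbT mul_polyC.
    by rewrite (leq_trans (size_scale_leq _ _)) ?size_polyX.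
  by move: szp; set u := size _; set v := size _; lia.
rewrite mulrDl -mulrA coefD !coefCM coefXM /= pn.
by rewrite (nth_default _ szp) mulr0 addr0.
Qed.

Lemma size_det_pencil n (A B : 'M[K]_n) : (size (\det (pencil A B)) <= n.+1)%N.
Proof. by apply: size_det_le => i j; apply: size_pencil. Qed.

Lemma coef_det_pencil n (A B : 'M[K]_n) : (\det (pencil A B))`_n = \det A.
Proof.
rewrite /determinant coef_sum; apply: eq_bigr => s _.
have -> : (-1) ^+ s = ((-1) ^+ s)%:P :> {poly K}.
  by rewrite rmorph_sign.
rewrite coefCM; congr (_ * _).
rewrite (eq_bigr (fun i => (A i (s i))%:P * 'X + (B i (s i))%:P)).
  exact: (prod_linear _ _).2.
by move=> i _; rewrite pencilE.
Qed.

Lemma lead_coef_det_pencil n (A B : 'M[K]_n) :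
  \det A != 0 -> lead_coef (\det (pencil A B)) = \det A /\ size (\det (pencil A B)) = n.+1.
Proof.
move=> dA; have sz : size (\det (pencil A B)) = n.+1.
  apply/eqP; rewrite eqn_leq size_det_pencil /= ltnNge; apply: contra dA => sz.
  by rewrite -(coef_det_pencil A B) nth_default.
by rewrite lead_coefE sz coef_det_pencil.
Qed.

End Pencil.

Lemma map_det_pencil (K K' : comNzRingType) (f : {rmorphism K -> K'}) n (A B : 'M[K]_n) :
  map_poly f (\det (pencil A B)) = \det (pencil (map_mx f A) (map_mx f B)).
Proof.
rewrite -det_map_mx; congr (\det _); apply/matrixP => i j.
by rewrite mxE !pencilE rmorphD rmorphM /= map_polyX !map_polyC /= !mxE.
Qed.

(** * Splitting a symmetric pencil along an invariant subspace *)

Section Split.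
Variable K : fieldType.

(** Multiplying z N = ('X - x) z A by the adjugate of N = 'X A + B gives
    z_k det N = ('X - x) d, where d is the determinant of N with row k replaced
    by z A. If z A z^T = 0, all rows of that matrix at x are orthogonal to z, so
    that d(x) = 0 and x is a multiple root of det N. *)
Lemma separable_root_anisotropic n (A B : 'M[K]_n) x (z : 'rV_n) :
    A^T = A -> B^T = B -> separable_poly (\det (pencil A B)) ->
    z != 0 -> z *m (x *: A + B) = 0 ->
  z *m A *m z^T != 0.
Proof.
move=> symA symB sepAB z0 zN; apply/eqP => zAz.
have [k zk] : exists k, z 0 k != 0 by apply/rV0Pn.
set c := \det _ in sepAB; pose r := map_mx polyC (z *m A).
pose d := (r *m \adj (pencil A B)) 0 k.
have zB : z *m B = - (x *: (z *m A)).
  by apply/eqP; rewrite -addr_eq0 addrC -zN mulmxDr -scalemxAr.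
have cd : (z 0 k) *: c = ('X - x%:P) * d.
  have : map_mx polyC z *m pencil A B = ('X - x%:P) *: r.
    rewrite /pencil mulmxDr -scalemxAr -!map_mxM zB scalerBl; congr (_ + _).
    by rewrite map_mxN map_mxZ.
  move/(congr1 (fun u => (u *m \adj (pencil A B)) 0 k)).
  rewrite -mulmxA mul_mx_adj mul_mx_scalar -scalemxAl !mxE -/c mulrC.
  by rewrite mul_polyC => ->; rewrite /d mxE.
have dx : d.[x] = 0.
  pose N := x *: A + B; pose M := \matrix_(i, j) if i == k then (z *m A) 0 j else N i j.
  have -> : d.[x] = \det M.
    rewrite -[LHS]/(horner_eval x _) /d; set P := r *m _.
    have -> : horner_eval x (P 0 k) = (map_mx (horner_eval x) P) 0 k by rewrite [RHS]mxE.
    rewrite map_mxM map_mx_adj pencil_horner -/N.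
    have -> : map_mx (horner_eval x) r = z *m A.
      by apply/matrixP => i j; rewrite !mxE /horner_eval hornerC.
    rewrite (expand_det_row _ k) mxE; apply: eq_bigr => j _; rewrite !mxE eqxx.
    congr (_ * _); rewrite /cofactor; congr (_ * \det _).
    by apply/matrixP => a b; rewrite !mxE eq_sym (negPf (neq_lift _ _)).
  apply/eqP; rewrite -det_tr; apply/det0P; exists z => //.
  apply/rowP => j; rewrite mxE [RHS]mxE.
  have [->|jk] := eqVneq j k.
    transitivity ((z *m A *m z^T) 0 0); last by rewrite zAz mxE.
    by rewrite mxE; apply: eq_bigr => i _; rewrite !mxE eqxx mulrC.
  transitivity ((z *m N) 0 j); last by rewrite zN mxE.
  have symN : N^T = N by rewrite /N linearD linearZ /= symA symB.
  rewrite -symN mxE; apply: eq_bigr => i _; rewrite [M^T _ _]mxE [M _ _]mxE (negPf jk).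
  by rewrite [N^T _ _]mxE.
have : ('X - x%:P) ^+ 2 %| c.
  rewrite -(dvdpZr _ _ zk) cd expr2 dvdp_mul2l ?polyXsubC_eq0 //.
  by rewrite dvdp_XsubCl; apply/rootP.
by rewrite (separable_nosquare sepAB) // size_XsubC.
Qed.

Lemma exists_row_basis m n (M : 'M[K]_(m, n)) r : \rank M = r ->
  exists2 U : 'M[_]_(r, n), row_free U & (U :=: M)%MS.
Proof. by case: r /; exists (row_base M); [apply: row_base_free | apply: eq_row_base]. Qed.

Lemma rank_congr_le k m (V : 'M[K]_(k, m)) (A : 'M[_]_m) :
  V *m A *m V^T \in unitmx -> (k <= m)%N.
Proof.
rewrite -row_free_unit => /eqP rk.
by rewrite -rk -mulmxA (leq_trans (mxrankM_maxl _ _)) ?rank_leq_col.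
Qed.

(** V spans a subspace that is invariant for the pencil. When A is nondegenerate
    on it, its A-orthogonal complement is a supplement, and the invariance makes
    the two subspaces B-orthogonal as well. *)
Lemma split_pencil k m (V : 'M[K]_(k, k + m)) (A B : 'M[_]_(k + m)) (M : 'M[_]_k)
    (G := V *m A *m V^T) :
    A^T = A -> B^T = B -> V *m B = - (M *m (V *m A)) -> G \in unitmx ->
  exists Q A2 B2, [/\ Q \in unitmx, A2^T = A2 :> 'M[_]_m, B2^T = B2,
    Q *m A *m Q^T = block_mx G 0 0 A2 & Q *m B *m Q^T = block_mx (- (M *m G)) 0 0 B2].
Proof.
move=> symA symB VB Gu.
have rk : \rank (kermx (A *m V^T)) = m.
  suff r : \rank (A *m V^T) = k by rewrite mxrank_ker r addnC addnK.
  apply/eqP; rewrite eqn_leq rank_leq_col /=; move: Gu; rewrite -row_free_unit.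
  by move=> /eqP {1}<-; rewrite /G -mulmxA mxrankM_maxr.
have [U Ufree /eqmxP/andP[/sub_kermxP UAV _]] := exists_row_basis rk.
have VAU : V *m A *m U^T = 0.
  by apply: trmx_inj; rewrite !trmx_mul trmxK symA mulmxA -mulmxA UAV linear0.
have UBV : U *m B *m V^T = 0.
  have -> : U *m B *m V^T = U *m (V *m B)^T by rewrite trmx_mul symB mulmxA.
  rewrite VB linearN /= !trmx_mul symA mulmxN.
  by rewrite mulmxA UAV mul0mx oppr0.
have VBU : V *m B *m U^T = 0.
  by apply: trmx_inj; rewrite !trmx_mul trmxK symB mulmxA UBV linear0.
exists (col_mx V U), (U *m A *m U^T), (U *m B *m U^T); split.
- rewrite -row_free_unit; apply/inj_row_free => v; rewrite -[v]hsubmxK mul_row_col.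
  set a := lsubmx v; set b := rsubmx v => ab0.
  have a0 : a = 0.
    have := congr1 (mulmx^~ (A *m V^T)) ab0.
    rewrite mulmxDl -(mulmxA b) UAV mulmx0 addr0 mul0mx -mulmxA => aG.
    by rewrite -[a](mulmxK Gu) /G -(mulmxA V) aG mul0mx.
  move: ab0; rewrite a0 mul0mx add0r => /eqP; rewrite mulmx_free_eq0 // => /eqP ->.
  by rewrite row_mx0.
- by rewrite !trmx_mul trmxK symA mulmxA.
- by rewrite !trmx_mul trmxK symB mulmxA.
- rewrite tr_col_mx mul_col_mx mul_col_row -!mulmxA UAV !mulmxA VAU.
  by rewrite -/G.
- rewrite tr_col_mx mul_col_mx mul_col_row UBV VBU; congr block_mx.
  by rewrite VB mulNmx -mulmxA -/G.
Qed.

End Split.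

(** * Residues attained by the adjugate of a pencil *)

Section Realisable.
Variable R : rcfType.

(** When N = pencil A B has a nonzero determinant, w = f adj(N); the condition
    then says that - t is the residue of f adj(N) f^T modulo det N. Working with w
    rather than with the adjugate makes congruences and block sums immediate. *)
Definition attains n (A B : 'M[R]_n) (t : {poly R}) : Prop :=
  exists (f : 'rV[R]_n) (w : 'rV[{poly R}]_n),
    w *m pencil A B = \det (pencil A B) *: map_mx polyC f
    /\ \det (pencil A B) %| (w *m (map_mx polyC f)^T) 0 0 + t.

(** The factor h carries the real roots of the determinant: there the residue
    of f adj(N) f^T has a fixed sign, and only the value 0 is asked for. *)
Definition realisable n (A B : 'M[R]_n) : Prop :=
  exists rs : seq R, let h := \prod_(r <- rs) ('X - r%:P) in
    [/\ uniq rs, h %| \det (pencil A B) & forall t, attains A B (h * t)].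

Lemma det_pencil_congr n (Q A B : 'M[R]_n) :
  \det (pencil (Q *m A *m Q^T) (Q *m B *m Q^T)) =
  (\det Q ^+ 2) *: \det (pencil A B).
Proof.
rewrite pencil_congr !det_mulmx det_tr det_map_mx mulrAC -expr2 -rmorphXn /=.
by rewrite mul_polyC.
Qed.

Lemma realisable_congr n (Q A B : 'M[R]_n) : Q \in unitmx ->
  realisable (Q *m A *m Q^T) (Q *m B *m Q^T) -> realisable A B.
Proof.
move=> Qu; rewrite /realisable /attains det_pencil_congr pencil_congr.
set q := _ ^+ 2; have q0 : q != 0 by rewrite expf_neq0 // -unitfE -unitmxE.
set c := \det _ => -[rs [rs_uniq hc at_h]]; exists rs; split=> //.
  by rewrite -(dvdpZr _ _ q0).
set h := \prod_(_ <- _) _ in at_h * => t; have [f [w [wN wf]]] := at_h (q *: t).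
pose Qc := map_mx polyC Q; have Qcu : Qc \in unitmx.
  by rewrite unitmxE det_map_mx rmorph_unit // -unitmxE.
exists (f *m invmx Q^T), (q^-1%:P *: (w *m Qc)).
have fE : map_mx polyC (f *m invmx Q^T) = map_mx polyC f *m invmx Qc^T.
  by rewrite map_mxM map_invmx map_trmx.
split.
  rewrite -scalemxAl fE; apply: (can_inj (mulmxK (_ : Qc^T \in unitmx))).
    by rewrite unitmx_tr.
  rewrite -scalemxAl -[w *m Qc *m _]mulmxA -[w *m _ *m _]mulmxA wN scalerA.
  rewrite -scalemxAl mulmxKV ?unitmx_tr // -mul_polyC mulrA -polyCM mulVf //.
  by rewrite mul1r.
rewrite fE trmx_mul trmx_inv trmxK -scalemxAl !mulmxA mulmxK // mxE.
have -> : q^-1%:P * (w *m (map_mx polyC f)^T) 0 0 + h * t =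
    q^-1 *: ((w *m (map_mx polyC f)^T) 0 0 + h * (q *: t)).
  by rewrite scalerDr -scalerAr scalerA mulVf // scale1r mul_polyC.
by rewrite dvdpZr ?invr_eq0 // -(dvdpZl _ _ q0).
Qed.

(** Chinese remainders: for a block sum, f adj(N) f^T equals
    c2 (f1 adj(N1) f1^T) + c1 (f2 adj(N2) f2^T). *)
Lemma attains_block n1 n2 (A1 B1 : 'M[R]_n1) (A2 B2 : 'M[R]_n2) (t1 t2 t : {poly R})
    (c1 := \det (pencil A1 B1)) (c2 := \det (pencil A2 B2)) :
    coprimep c1 c2 -> attains A1 B1 t1 -> attains A2 B2 t2 ->
    c1 %| t - c2 * t1 -> c2 %| t - c1 * t2 ->
  attains (block_mx A1 0 0 A2) (block_mx B1 0 0 B2) t.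
Proof.
move=> co [f1 [w1 [wN1 wf1]]] [f2 [w2 [wN2 wf2]]] t1P t2P.
rewrite /attains pencil_block !pencil0 det_ublock -/c1 -/c2.
exists (row_mx f1 f2), (row_mx (c2 *: w1) (c1 *: w2)); split.
  rewrite mul_row_block !mulmx0 addr0 add0r -!scalemxAl wN1 wN2 !scalerA.
  by rewrite map_row_mx scale_row_mx [c2 * c1]mulrC.
rewrite map_row_mx tr_row_mx mul_row_col -!scalemxAl.
move: (w1 *m _) (w2 *m _) wf1 wf2 => W1 W2; rewrite -/c1 -/c2 !mxE.
move: (W1 0 0) (W2 0 0) => u v wf1 wf2.
rewrite Gauss_dvdp //; apply/andP; split.
  rewrite (_ : _ + t = c2 * (u + t1) + c1 * v + (t - c2 * t1)); last by ring.
  by rewrite dvdp_add // dvdp_add ?dvdp_mulIl // dvdp_mull.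
rewrite (_ : _ + t = c1 * (v + t2) + c2 * u + (t - c1 * t2)); last by ring.
by rewrite dvdp_add // dvdp_add ?dvdp_mulIl // dvdp_mull.
Qed.

Lemma attains0 n (A B : 'M[R]_n) : attains A B 0.
Proof.
exists 0, 0; rewrite map_mx0 mul0mx scaler0 trmx0 mul0mx mxE addr0.
by rewrite dvdp0.
Qed.

(** The row f is extended by 0 on the new block, which makes the residue vanish
    at its root l; so l joins the list of real roots. *)
Lemma realisable_real_block n (g l : R) (A B : 'M[R]_n)
    (A' := block_mx g%:M 0 0 A) (B' := block_mx (- (l *: g%:M)) 0 0 B : 'M[_]_(1 + n)) :
  g != 0 -> separable_poly (\det (pencil A' B')) ->
  realisable A B -> realisable A' B'.
Proof.
move=> g0.
have d1 : \det (pencil g%:M (- (l *: g%:M)) : 'M[_]_1) = g *: ('X - l%:P).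
  rewrite det_mx11 pencilE !mxE eqxx !mulr1n polyCN polyCM -mul_polyC; ring.
have dd : \det (pencil A' B') = g *: ('X - l%:P) * \det (pencil A B).
  by rewrite /A' /B' pencil_block !pencil0 det_ublock d1.
move=> sep [rs [rs_uniq hc at_h]]; move: (sep); rewrite dd.
rewrite separable_mul => /and3P[_ _ co].
exists (l :: rs); rewrite big_cons; split.
- rewrite /= rs_uniq andbT; apply/negP => lrs.
  have : ('X - l%:P) %| \det (pencil A B).
    by apply: dvdp_trans hc; rewrite (big_rem l) //= dvdp_mulIl.
  rewrite dvdp_XsubCl; move: co; rewrite coprimepZl // coprimep_sym.
  by rewrite coprimep_XsubC => /negP.
- by rewrite dd dvdp_mul // dvdpZr.
set h := \prod_(_ <- _) _ in hc at_h * => t.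
apply: (@attains_block _ _ _ _ _ _ 0 (h * (g^-1 *: t))) => //.
- by rewrite d1.
- exact: attains0.
- by rewrite d1 mulr0 subr0 dvdpZl // -mulrA dvdp_mulIl.
rewrite d1 -!scalerAr -!scalerAl scalerA mulVf // scale1r mulrA subrr.
by rewrite dvdp0.
Qed.

(** A Bezout relation between the two coprime determinants distributes the
    target over the two blocks. *)
Lemma realisable_complex_block n (A1 B1 : 'M[R]_2) (A B : 'M[R]_n)
    (A' := block_mx A1 0 0 A) (B' := block_mx B1 0 0 B) :
  separable_poly (\det (pencil A' B')) -> (forall t, attains A1 B1 t) ->
  realisable A B -> realisable A' B'.
Proof.
have dd : \det (pencil A' B') = \det (pencil A1 B1) * \det (pencil A B).
  by rewrite /A' /B' pencil_block !pencil0 det_ublock.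
rewrite dd separable_mul => /and3P[_ _ co] at1 [rs [rs_uniq hc at_h]].
exists rs; split=> //; first by rewrite dd dvdp_mull.
set h := \prod_(_ <- _) _ in hc at_h * => t.
have /Bezout_eq1_coprimepP[[u v] /= uv] := co.
apply: (@attains_block _ _ _ _ _ _ (v * (h * t)) (h * (u * t))) => //.
  rewrite (_ : _ - _ = (1 - v * \det (pencil A B)) * (h * t)); last by ring.
  by rewrite -uv addrK dvdp_mulr // dvdp_mulIr.
rewrite (_ : _ - _ = (1 - u * \det (pencil A1 B1)) * (h * t)); last by ring.
by rewrite -uv addrC addKr dvdp_mulr // dvdp_mulIr.
Qed.

End Realisable.

Section RealisableGeneric.
Variable R : rcfType.

Lemma det_mx22 (K : comNzRingType) (M : 'M[K]_2) :
  \det M = M 0 0 * M 1 1 - M 0 1 * M 1 0.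
Proof.
rewrite (expand_det_row _ 0) !big_ord_recl big_ord0 /cofactor !det_mx11 !mxE /=.
have -> : lift 0 0 = 1 :> 'I_2 by apply/val_inj.
have -> : lift 1 0 = 0 :> 'I_2 by apply/val_inj.
by rewrite addr0 expr0 expr1 mul1r mulN1r mulrN.
Qed.

Lemma exists_complex_sqrt (x y : R) : exists u v, v ^+ 2 - u ^+ 2 = x /\ 2 * u * v = y.
Proof.
have := sqrtCK (Complex x y); case: (sqrtC _) => v u /= [<- <-].
by exists u, v; split; ring.
Qed.

(** Up to congruence, a 2 x 2 pencil with the roots a +- i b is the real part of
    the complex quadratic form z |-> (p - i q) ('X - (a - i b)) z^2. To prescribe
    a residue, i.e. a linear polynomial, is therefore to solve a single equation
    in the square of a complex number. *)
Lemma attains_complex (p q a b : R)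
    (G := block_mx p%:M q%:M q%:M (- p)%:M : 'M[_]_(1 + 1))
    (M := block_mx a%:M (- b)%:M b%:M a%:M : 'M[_]_(1 + 1)) :
  b != 0 -> G != 0 -> forall t, attains G (- (M *m G)) t.
Proof.
move=> b0 G0 t; pose s := p ^+ 2 + q ^+ 2.
have s0 : s != 0.
  apply: contra G0; rewrite paddr_eq0 ?sqr_ge0 // !sqrf_eq0 => /andP[/eqP p0 /eqP q0].
  apply/eqP; rewrite /G p0 q0 oppr0 !raddf0.
  by rewrite -[RHS](@block_mx0 _ 1 1 1 1).
pose y : {poly R} := 'X - a%:P.
pose n0 : {poly R} := p%:P * y + (b * q)%:P.
pose n1 : {poly R} := q%:P * y - (b * p)%:P.
have NE : pencil G (- (M *m G)) = block_mx n0%:M n1%:M n1%:M (- n0)%:M.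
  have pen1 (u v : R) : pencil u%:M v%:M = (u%:P * 'X + v%:P)%:M :> 'M[_]_1.
    by apply/matrixP => i j; rewrite pencilE !ord1 !mxE eqxx.
  have oppE (u : R) : - u%:M = (- u)%:M :> 'M[_]_1 by rewrite raddfN.
  rewrite /M /G mulmx_block -!scalar_mxM -!raddfD /= opp_block_mx !oppE.
  rewrite pencil_block !pen1; congr block_mx; congr (_ %:M);
    rewrite /n0 /n1 /y ?(polyCN, polyCD, polyCM); ring.
rewrite /attains NE.
set N := block_mx _ _ _ _; set c := \det N.
have cE : c = - (n0 ^+ 2 + n1 ^+ 2).
  rewrite /c det_mx22 /N.
  have e0 : (0 : 'I_2) = lshift 1 (0 : 'I_1) by apply/val_inj.
  have e1 : (1 : 'I_2) = rshift 1 (0 : 'I_1) by apply/val_inj.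
  rewrite e0 e1; pose u : 'M[_]_1 := n0%:M; pose v : 'M[_]_1 := n1%:M; pose w : 'M[_]_1 := (- n0)%:M.
  rewrite (block_mxEul u v v w) (block_mxEur u v v w).
  rewrite (block_mxEdl u v v w) (block_mxEdr u v v w) !mxE eqxx !mulr1n; ring.
have szc : size c = 3.
  have -> : c = - (s *: (y ^+ 2 + (b ^+ 2)%:P)).
    rewrite cE -mul_polyC /n0 /n1 /s !(polyCD, polyCM, polyCN); ring.
  rewrite size_polyN size_scale // size_polyDl ?size_exp_XsubC //.
  by rewrite (leq_ltn_trans (size_polyC_leq1 _)).
pose r := t %% c.
have szr : (size r <= 2)%N.
  have c0 : c != 0 by rewrite -size_poly_eq0 szc.
  by have := ltn_modpN0 t c0; rewrite szc ltnS.
have [r1 [r0 rE]] : exists r1 r0, r = r1 *: y + r0%:P.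
  exists r`_1, (r`_0 + a * r`_1); apply/polyP => i.
  rewrite /y !coefE; case: i => [|[|i]] //=.
  - ring.
  - ring.
  by rewrite nth_default ?(leq_trans szr) //; ring.
(* f1 ^+ 2 - f0 ^+ 2 and 2 f0 f1 solve the linear system obtained by comparing
   the coefficients of y and of 1; its determinant is b s. *)
pose x1 := (- p * r1 - q * r0 / b) / s.
pose x2 := (- p * r0 / b + q * r1) / s.
have [f0 [f1 [fx1 fx2]]] := exists_complex_sqrt x1 x2.
exists (row_mx f0%:M f1%:M).
exists (row_mx (- n0 * f0%:P - n1 * f1%:P)%:M (n0 * f1%:P - n1 * f0%:P)%:M).
rewrite map_row_mx !map_scalar_mx /=; split.
  rewrite /N mul_row_block -!scalar_mxM -!raddfD /= scale_row_mx !scale_scalar_mx.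
  congr row_mx; congr (_%:M); rewrite cE; ring.
rewrite tr_row_mx !tr_scalar_mx mul_row_col -!scalar_mxM -raddfD mxE eqxx mulr1n.
rewrite (divp_eq t c) addrCA dvdp_addr ?dvdp_mulIr // -/r.
suff -> : (- n0 * f0%:P - n1 * f1%:P) * f0%:P + (n0 * f1%:P - n1 * f0%:P) * f1%:P + r = 0.
  exact: dvdp0.
transitivity ((p * (f1 ^+ 2 - f0 ^+ 2) - q * (2 * f0 * f1) + r1) *: y
  + (b * (q * (f1 ^+ 2 - f0 ^+ 2) + p * (2 * f0 * f1)) + r0)%:P).
  by rewrite -mul_polyC rE -mul_polyC /n0 /n1 !(polyCD, polyCM, polyCN, polyC_exp); ring.
rewrite fx1 fx2 (_ : p * x1 - q * x2 + r1 = 0); last first.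
  by rewrite /x1 /x2 /s; field; rewrite -/s b0 s0.
rewrite (_ : b * (q * x1 + p * x2) + r0 = 0) ?scale0r ?addr0 //.
by rewrite /x1 /x2 /s; field; rewrite -/s b0 s0.
Qed.

Local Notation toC := (map_mx (real_complex R)).

(** The two real equations are the real and imaginary parts of z (x A + B) = 0. *)
Lemma pencil_complex_kernel n (A B : 'M[R]_n) :
    (1 < size (\det (pencil A B)))%N ->
  exists (a b : R) (u v : 'rV[R]_n),
    let z := toC u + 'i%C *: toC v in let x := (a +i* b)%C in
    [/\ z != 0, z *m (x *: toC A + toC B) = 0,
        root (map_poly (real_complex R) (\det (pencil A B))) x,
        u *m B = b *: (v *m A) - a *: (u *m A) &
        v *m B = - (b *: (u *m A)) - a *: (v *m A)].
Proof.
move=> szc.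
pose cC := map_poly (real_complex R) (\det (pencil A B)).
have /closed_rootP[x x_root] : size cC != 1.
  by rewrite size_map_poly; apply: contraTneq szc => ->.
have /det0P[z z0 zN] : \det (x *: toC A + toC B) == 0.
  by rewrite -det_pencil_horner -map_det_pencil; exact: x_root.
case: x x_root zN => a b x_root zN.
pose u : 'rV_n := map_mx (fun y : R[i]%C => let: (r +i* _)%C := y in r) z.
pose v : 'rV_n := map_mx (fun y : R[i]%C => let: (_ +i* r)%C := y in r) z.
have zE : z = toC u + 'i%C *: toC v.
  by apply/matrixP => i j; rewrite !mxE; case: (z i j) => r s; simpc.
have splitC (s t : 'rV[R]_n) : toC s + 'i%C *: toC t = 0 -> s = 0 /\ t = 0.
  move=> /matrixP st; split; apply/matrixP => i j; have := st i j; rewrite !mxE; simpc.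
    by move/(congr1 (fun y => let: (r +i* _)%C := y in r)).
  by move/(congr1 (fun y => let: (_ +i* r)%C := y in r)).
exists a, b, u, v; rewrite /= -zE.
have : toC (u *m B - (b *: (v *m A) - a *: (u *m A))) +
    'i%C *: toC (v *m B - (- (b *: (u *m A)) - a *: (v *m A))) = 0.
  rewrite -zN zE !(map_mxD, map_mxN, map_mxZ, map_mxM).
  have -> : (a +i* b)%C = real_complex R a + 'i%C * real_complex R b.
    by simpc.
  rewrite mulmxDr !mulmxDl -!scalemxAr -!scalemxAl.
  apply/matrixP => i j; rewrite !mxE.
  have := sqr_i R; set I := 'i%C => I2.
  move: (\sum_(_ < _) _) => X1; move: (\sum_(_ < _) _) => X2.
  move: (\sum_(_ < _) _) => X3; move: (\sum_(_ < _) _) => X4.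
  ring: I2.
by case/splitC => /eqP; rewrite subr_eq0 => /eqP uB /eqP; rewrite subr_eq0 => /eqP vB.
Qed.

(** Induction on the dimension: a real root of the determinant splits off a line
    on which A does not vanish, and a pair of conjugate roots splits off a plane
    on which A is nondegenerate; both facts are separable_root_anisotropic, used
    over the reals and over the complex numbers. *)
Lemma realisable_generic n (A B : 'M[R]_n) :
    A^T = A -> B^T = B -> \det A != 0 -> separable_poly (\det (pencil A B)) ->
  realisable A B.
Proof.
have [N] := ubnP n; elim: N => // N IH in n A B *; rewrite ltnS => leN.
move=> symA symB dA sep.
case: (posnP n) => [n0 | n_gt0].
  subst n; exists [::]; rewrite big_nil; split=> // [|t]; first exact: dvd1p.
  exists 0, 0; split; first by rewrite map_mx0 mul0mx scaler0.
  by rewrite det_mx00 dvd1p.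
have [lcc szc] := lead_coef_det_pencil B dA.
have reduce k m (e : n = (k + m)%N) (V : 'M[R]_(k, n)) (M : 'M[_]_k) (G := V *m A *m V^T) :
    (0 < k)%N -> V *m B = - (M *m (V *m A)) -> G \in unitmx ->
    (forall (A2 B2 : 'M[_]_m) (A' := block_mx G 0 0 A2) (B' := block_mx (- (M *m G)) 0 0 B2),
       separable_poly (\det (pencil A' B')) -> realisable A2 B2 -> realisable A' B') ->
    realisable A B.
  move=> k0 VB Gu blockP; subst n.
  have [Q [A2 [B2 [Qu symA2 symB2 QA QB]]]] := split_pencil symA symB VB Gu.
  apply: (realisable_congr Qu); rewrite QA QB.
  have dQ : \det Q != 0 by rewrite -unitfE -unitmxE.
  have sep' : separable_poly (\det (pencil (block_mx G 0 0 A2) (block_mx (- (M *m G)) 0 0 B2))).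
    rewrite -QA -QB det_pencil_congr.
    by rewrite (eqp_separable (eqp_scale _ _)) // expf_neq0.
  apply: blockP => //; apply: IH => //.
  - by rewrite (leq_trans _ leN) // -[ltnLHS]add0n ltn_add2r.
  - have : \det (block_mx G 0 0 A2) != 0.
      by rewrite -QA !det_mulmx det_tr !mulf_neq0.
    by rewrite det_ublock mulf_eq0 => /norP[].
  by move: sep'; rewrite pencil_block !pencil0 det_ublock separable_mul => /and3P[].
have [[l l_root]|no_root] := pselect (exists l, root (\det (pencil A B)) l).
  have /det0P[z z0 zN] : \det (l *: A + B) == 0 by rewrite -det_pencil_horner.
  have g0 := separable_root_anisotropic symA symB sep z0 zN.
  have e : n = (1 + n.-1)%N by lia.
  apply: (reduce 1%N n.-1 e z l%:M) => //.
  - rewrite mul_scalar_mx; apply/eqP; rewrite -addr_eq0 addrC -[X in _ == X]zN.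
    by rewrite mulmxDr -scalemxAr.
  - by rewrite unitmxE det_mx11 unitfE; apply: contra g0 => /eqP g; rewrite [_ *m z^T]mx11_scalar g raddf0.
  move=> A2 B2; rewrite [z *m A *m z^T]mx11_scalar; set g := _ 0 0.
  rewrite mul_scalar_mx; apply: realisable_real_block.
  by apply: contra g0 => /eqP g_0; rewrite [_ *m z^T]mx11_scalar -/g g_0 raddf0.
have [a [b [u [v [z0 zN x_root uB vB]]]]] := @pencil_complex_kernel n A B ltac:(by rewrite szc; lia).
have b0 : b != 0.
  apply/eqP => b0; apply: no_root; exists a; move: x_root.
  by rewrite b0 -[(a +i* 0)%C]/(real_complex R a) fmorph_root.
pose V : 'M[_]_(1 + 1, n) := col_mx u v.
pose M : 'M[R]_(1 + 1) := block_mx a%:M (- b)%:M b%:M a%:M.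
have VB : V *m B = - (M *m (V *m A)).
  rewrite /V /M !mul_col_mx !mul_row_col.
  rewrite !mul_scalar_mx uB vB opp_col_mx scaleNr opprB opprD.
  by congr col_mx; rewrite addrC.
pose p := (u *m A *m u^T) 0 0; pose q := (u *m A *m v^T) 0 0.
have vAu : v *m A *m u^T = u *m A *m v^T.
  by rewrite [RHS]mx11_scalar -tr_scalar_mx -mx11_scalar !trmx_mul trmxK symA mulmxA.
have vBu : v *m B *m u^T = u *m B *m v^T.
  by rewrite [RHS]mx11_scalar -tr_scalar_mx -mx11_scalar !trmx_mul trmxK symB mulmxA.
(* By symmetry of B, the plane spanned by u and v has an A-Gram matrix of trace
   zero. *)
have vAv : v *m A *m v^T = - (u *m A *m u^T).
  move: vBu; rewrite uB vB !mulmxDl !mulNmx -!scalemxAl vAu => /addIr/eqP.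
  rewrite -subr_eq0 -opprD oppr_eq0 -scalerDr scaler_eq0 (negPf b0) /= addrC.
  by rewrite addr_eq0 => /eqP.
have GE : V *m A *m V^T = block_mx p%:M q%:M q%:M (- p)%:M.
  rewrite /V mul_col_mx tr_col_mx mul_col_row vAu vAv raddfN /= -!mx11_scalar.
  by [].
have G0 : block_mx p%:M q%:M q%:M (- p)%:M != 0 :> 'M[R]_(1 + 1).
  apply/eqP => G0; move: (GE); rewrite G0.
  rewrite /V mul_col_mx tr_col_mx mul_col_row -[RHS]block_mx0 => /eq_block_mx[uu uv vu vv].
  have sepC : separable_poly (\det (pencil (toC A) (toC B))).
    by rewrite -map_det_pencil separable_map.
  apply: (elimN eqP (separable_root_anisotropic _ _ sepC z0 zN)).
  - by rewrite map_trmx symA.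
  - by rewrite map_trmx symB.
  rewrite linearD linearZ /= !map_trmx !mulmxDr !mulmxDl -!scalemxAr -!scalemxAl.
  by rewrite -!map_mxM uu uv vu vv !map_mx0 !scaler0 !addr0.
have Gu : V *m A *m V^T \in unitmx.
  rewrite GE; set G := block_mx _ _ _ _ in G0 *; pose s := p ^+ 2 + q ^+ 2.
  have s0 : s != 0.
    apply: contra G0; rewrite paddr_eq0 ?sqr_ge0 // !sqrf_eq0 => /andP[/eqP p0 /eqP q0].
    by rewrite /G p0 q0 oppr0 !raddf0 block_mx0.
  have GG : G *m (s^-1 *: G) = 1%:M.
    rewrite -scalemxAr /G mulmx_block -!scalar_mxM -!raddfD /=.
    have -> : p * q + q * - p = 0 by ring.
    have -> : q * p + - p * q = 0 by ring.
    have -> : p * p + q * q = s by rewrite /s; ring.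
    have -> : q * q + - p * - p = s by rewrite /s; ring.
    by rewrite raddf0 -scalar_mx_block scale_scalar_mx mulVf.
  by case/mulmx1_unit: GG.
have le2n := rank_congr_le Gu.
have e : n = (2 + (n - 2))%N by lia.
apply: (reduce 2%N (n - 2)%N e V M) => //.
move=> A2 B2 A' B' sepAB'; apply: realisable_complex_block => //.
by rewrite GE; apply: attains_complex.
Qed.
End RealisableGeneric.

(** * Generic pencils on a line *)

Section Generic.
Variable R : numFieldType.

Lemma separable_resultant (p : {poly R}) : (1 < size p)%N ->
  separable_poly p = (resultant p p^`() != 0).
Proof.
move=> szp; have p0 : p != 0 by rewrite -size_poly_gt0 ltnW.
rewrite unlock resultant_eq0 /coprimep -leqNgt eqn_leq.
by rewrite [(0 < _)%N]size_poly_gt0 gcdp_eq0 (negPf p0) andbT.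
Qed.

(** Invertibility of A and separability of the determinant are, along a line,
    the nonvanishing of a determinant and of a resultant, both polynomial in t.
    They hold at t = 1, where the pencil is 'X - diag (0, ..., n-1). *)
Lemma generic_line n (A B : 'M[R]_n) (D : 'M[R]_n := diag_mx (\row_i - i%:R)) :
  exists2 r : {poly R}, r != 0 & forall t, r.[t] != 0 ->
    \det (t *: (1%:M - A) + A) != 0 /\
    separable_poly (\det (pencil (t *: (1%:M - A) + A) (t *: (D - B) + B))).
Proof.
case: (posnP n) => [n0|n_gt0].
  subst n; exists 1; rewrite ?oner_neq0 // => t _; rewrite !det_mx00 oner_neq0.
  by rewrite unlock coprime1p.
pose PA := pencil (1%:M - A) A; pose PB := pencil (D - B) B.
pose q := \det (pencil PA PB).
have PA1 : (\det PA).[1] = 1 by rewrite det_pencil_horner scale1r subrK det1.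
have PA0 : \det PA != 0 by apply/eqP => PA0; move/eqP: PA1; rewrite PA0 horner0 eq_sym oner_eq0.
have [lq szq] := lead_coef_det_pencil PB PA0; rewrite -/q in lq szq.
have nR : n%:R != 0 :> R by rewrite pnatr_eq0 -lt0n.
have dq : q^`()`_n.-1 = n%:R%:P * \det PA.
  by rewrite coef_deriv prednK // /q coef_det_pencil rmorph_nat mulr_natl.
have szq' : size q^`() = n.
  apply/eqP; rewrite eqn_leq -ltnS -szq lt_size_deriv -?size_poly_eq0 ?szq //=.
  rewrite -(prednK n_gt0) ltnNge; apply/negP => /(nth_default 0)/eqP.
  by rewrite dq mulf_eq0 polyC_eq0 (negPf nR) (negPf PA0).
have lq' : lead_coef q^`() = n%:R%:P * \det PA by rewrite lead_coefE szq'.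
have qt t : map_poly (horner_eval t) q =
    \det (pencil (t *: (1%:M - A) + A) (t *: (D - B) + B)).
  by rewrite /q map_det_pencil !pencil_horner.
have dt t : (\det PA).[t] = \det (t *: (1%:M - A) + A) by apply: det_pencil_horner.
have rt t : (\det PA).[t] != 0 -> ((resultant q q^`()).[t] != 0) =
    separable_poly (\det (pencil (t *: (1%:M - A) + A) (t *: (D - B) + B))).
  move=> PAt; rewrite separable_resultant; last first.
    by rewrite (lead_coef_det_pencil _ _).2 -?dt // ltnS.
  rewrite -qt deriv_map -map_resultant //.
    by rewrite lq.
  rewrite lq' -[X in X != 0]/((n%:R%:P * \det PA).[t]) hornerM hornerC.
  by rewrite mulf_neq0.
exists (\det PA * resultant q q^`()).
  rewrite mulf_neq0 //; apply/eqP => r0.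
  have := rt 1; rewrite PA1 oner_neq0 => /(_ isT); rewrite r0 horner0 eqxx.
  rewrite !scale1r !subrK => /esym/negP; apply.
  have -> : pencil 1%:M D = diag_mx (\row_i ('X - (i%:R)%:P)).
    apply/matrixP => i j; rewrite pencilE !mxE.
    by case: eqVneq => [->|]; rewrite ?mul0r ?mul1r ?addr0 ?polyCN ?mulr1n ?mulr0n ?polyC0 ?mul0r ?addr0.
  rewrite det_diag (eq_bigr (fun i : 'I_n => 'X - (i%:R)%:P)); last by move=> i _; rewrite mxE.
  rewrite -(big_map (fun i : 'I_n => i%:R : R) xpredT (fun x => 'X - x%:P)).
  rewrite separable_prod_XsubC map_inj_uniq ?index_enum_uniq //.
  by move=> i j /eqP; rewrite eqr_nat => /eqP/val_inj.
move=> t; rewrite hornerM mulf_eq0 => /norP[PAt].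
by rewrite rt // -dt.
Qed.

End Generic.

(** * Determinant of the perturbed normal form *)

Section Bordered.
Variable K : comUnitRingType.

(** The sign of the permutation exchanging two blocks of size k. *)
Definition swap_det k : K := \det (block_mx 0 1%:M 1%:M 0 : 'M[K]_(k + k)).

Lemma swap_det_sqr k : swap_det k * swap_det k = 1.
Proof.
rewrite /swap_det -det_mulmx mulmx_block !mulmx0 !mul0mx !mulmx1 !addr0 !add0r.
by rewrite -scalar_mx_block det1.
Qed.

(** Schur complement of the block (E, L; L^T, 0), which is inverted by inverting
    L alone. *)
Lemma det_bordered k m (E L : 'M[K]_k) (u l : 'rV[K]_k) (e : 'M[K]_1) (f : 'rV[K]_m) N :
    L \in unitmx -> u *m L = - l ->
  \det (block_mx (block_mx E L L^T 0) (block_mx 0 0 l^T 0)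
                 (block_mx 0 l 0 0) (block_mx e f f^T N)) =
  swap_det k * \det L ^+ 2 * \det (block_mx (e + u *m E *m u^T) f f^T N).
Proof.
move=> Lu uL; set H := block_mx E L L^T 0.
have detH : \det H = swap_det k * \det L ^+ 2.
  have : \det H * swap_det k = \det L ^+ 2.
    rewrite /swap_det -det_mulmx mulmx_block !mulmx0 !mul0mx !mulmx1 !addr0 !add0r.
    by rewrite det_ublock det_tr.
  by move=> <-; rewrite mulrC -mulrA swap_det_sqr mulr1.
pose t : 'rV_k := - (u *m E *m invmx L^T).
pose T : 'M[_]_(1 + m, k + k) := block_mx u t 0 0.
rewrite -detH -(det_ublock H (block_mx 0 0 l^T 0)).
have tL : t *m L^T = - (u *m E) by rewrite mulNmx mulmxKV // unitmx_tr.
have tl : t *m l^T = u *m E *m u^T.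
  by rewrite -[l]opprK -uL linearN /= trmx_mul mulmxN mulmxA tL mulNmx opprK.
set P := block_mx H _ _ _.
transitivity (\det (block_mx 1%:M 0 T 1%:M *m P)).
  by rewrite det_mulmx det_lblock !det1 !mul1r.
rewrite /P mulmx_block !mul1mx !mul0mx !addr0; congr (\det (block_mx _ _ _ _)).
- rewrite /T /H mulmx_block !mul0mx !mulmx0 !addr0 tL subrr.
  by rewrite add_block_mx uL addNr !addr0 block_mx0.
- rewrite /T mulmx_block !mul0mx !mulmx0 !addr0 add0r tl.
  by rewrite add_block_mx !add0r addrC.
Qed.

End Bordered.

(** Schur complement with respect to N. Cramer's rule in the form
    w N = det N f avoids inverting N over the fraction field. *)
Lemma det_border (K : idomainType) m (e : K) (f w : 'rV[K]_m) (N : 'M[_]_m) :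
    \det N != 0 -> w *m N = \det N *: f ->
  \det (block_mx e%:M f f^T N : 'M[_]_(1 + m)) = e * \det N - (w *m f^T) 0 0.
Proof.
move=> cN wN; apply: (mulfI cN).
have d : \det (block_mx (\det N)%:M (- w) 0 1%:M : 'M[_]_(1 + m)) = \det N.
  by rewrite det_ublock det1 mulr1 det_mx11 mxE eqxx.
rewrite -{1}d -det_mulmx mulmx_block !mul0mx !mul1mx !add0r !mulNmx wN.
rewrite !mul_scalar_mx subrr det_lblock scale_scalar_mx det_mx11 !mxE eqxx mulr1n.
by rewrite mulrC [\det N * e]mulrC.
Qed.

Section NormalForm.
Variable R : fieldType.
Variables (k m : nat).

Definition shift_mx : 'M[R]_k := \matrix_(i, j) (i.+1 == j)%:R.
Definition head_row : 'rV[R]_k := \row_j (j == 0%N :> nat)%:R.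

(** nfA and nfB are the coefficients of the limit pencil: the bidiagonal block
    (shift_mx, - 1) with first row head_row, the free pencil N, and the
    perturbation made of f and of a diagonal of linear polynomials. The latter
    are cut out of the coefficients of e in pairs, since the diagonal entry of
    index i contributes to the determinant with the factor 'X^(2 i). *)
Definition nfA (e : {poly R}) (NA : 'M[R]_m) : 'M[_]_(k + k + (1 + m)) :=
  block_mx (block_mx (diag_mx (\row_i e`_(i.+1.*2.+1))) shift_mx shift_mx^T 0)
           (block_mx 0 0 head_row^T 0)
           (block_mx 0 head_row 0 0) (block_mx (e`_1)%:M 0 0 NA).

Definition nfB (e : {poly R}) (f : 'rV[R]_m) (NB : 'M[R]_m) : 'M[_]_(k + k + (1 + m)) :=
  block_mx (block_mx (diag_mx (\row_i e`_(i.+1.*2))) (- 1%:M) (- 1%:M) 0) 0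
           0 (block_mx (e`_0)%:M f f^T NB).

(** How a polynomial is read off the diagonal of nfA and nfB. *)
Lemma poly_pairs (e : {poly R}) j : (size e <= j.*2)%N ->
  e = \sum_(i < j) ((e`_i.*2.+1)%:P * 'X + (e`_i.*2)%:P) * 'X ^+ i.*2.
Proof.
move=> sze; have {1}-> : e = \sum_(i < j.*2) e`_i *: 'X^i.
  rewrite -poly_def; apply/polyP => i; rewrite coef_poly.
  by case: ltnP => // le; rewrite nth_default // (leq_trans sze).
elim: j {sze} => [|j IH]; first by rewrite !big_ord0.
rewrite doubleS !big_ord_recr /= IH -addrA; congr (_ + _).
by rewrite mulrDl -mulrA -exprS !mul_polyC addrC.
Qed.

(** The row ('X, ..., 'X^k), completed by 1 on the third block, is the kernel
    vector of the bidiagonal block; the diagonal pencil enters through its value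
    on it, which is e. *)
Lemma det_nf (e : {poly R}) (f : 'rV[R]_m) (NA NB : 'M[R]_m) (w : 'rV[{poly R}]_m)
    (c := \det (pencil NA NB)) :
    (size e <= k.+1.*2)%N -> c != 0 -> w *m pencil NA NB = c *: map_mx polyC f ->
  \det (pencil (nfA e NA) (nfB e f NB)) =
  swap_det _ k * (e * c - (w *m (map_mx polyC f)^T) 0 0).
Proof.
move=> sze c0 wN.
pose L := pencil shift_mx (- 1%:M); pose l := pencil head_row 0.
pose u : 'rV[{poly R}]_k := \row_j 'X^(j.+1).
pose E := pencil (diag_mx (\row_i e`_(i.+1.*2.+1))) (diag_mx (\row_(i < k) e`_(i.+1.*2))).
have LE i j : L i j = (i.+1 == j)%:R * 'X - (i == j)%:R.
  by rewrite pencilE !mxE polyCN !rmorph_nat.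
have detL : \det L ^+ 2 = 1.
  rewrite -det_tr det_trig.
    rewrite (eq_bigr (fun=> -1)) => [|i _]; last first.
      by rewrite mxE LE eqxx gtn_eqF // mul0r add0r.
    by rewrite prodr_const -exprM mulnC exprM sqrrN !expr1n.
  apply/is_trig_mxP => i j ij; rewrite mxE LE.
  rewrite [j == i]gtn_eqF // [j.+1 == i]gtn_eqF ?mul0r ?subr0 //.
  by rewrite (ltn_trans ij).
have Lu : L \in unitmx.
  by rewrite unitmxE; apply/unitrPr; exists (\det L); rewrite -expr2.
have uL : u *m L = - l.
  apply/rowP => j; rewrite mxE.
  rewrite (eq_bigr (fun i : 'I_k => (i.+1 == j)%:R * 'X^(i.+2) - (i == j)%:R * 'X^(j.+1))); last first.
    move=> i _; rewrite mxE LE mulrBr mulrC -mulrA -exprS; congr (_ - _).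
    by case: eqVneq => [->|]; rewrite ?mulr0 ?mul0r // mulrC.
  rewrite mxE pencilE !mxE rmorph_nat polyC0 addr0.
  rewrite sumrB; set s1 := \sum_(_ < _) _; set s2 := \sum_(_ < _) _.
  have -> : s2 = 'X^(j.+1).
    rewrite /s2 (bigD1 j) //= eqxx mul1r big1 ?addr0 // => i /negPf ->.
    by rewrite mul0r.
  have [j0|j_gt0] := posnP j.
    rewrite /s1 j0 big1 ?mul1r ?sub0r ?expr1 // => i _; by rewrite mul0r.
  have jk : (j.-1 < k)%N by rewrite (leq_ltn_trans _ (ltn_ord j)) // leq_pred.
  have -> : s1 = 'X^(j.+1).
    rewrite /s1 (bigD1 (Ordinal jk)) //= prednK // eqxx mul1r big1 ?addr0 // => i ni.
    rewrite (_ : (i.+1 == j) = false) ?mul0r //.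
    apply: contraNF ni => /eqP ij; apply/eqP/val_inj => /=; by rewrite -ij.
  by rewrite subrr mul0r oppr0.
have uEu : (e`_1 *: 'X + (e`_0)%:P)%:M + u *m E *m u^T = e%:M.
  rewrite [u *m E *m u^T]mx11_scalar -raddfD; congr (_ %:M).
  rewrite [in RHS](poly_pairs sze) big_ord_recl /= double0 expr0 mulr1.
  rewrite mul_polyC; congr (_ + _).
  have -> : u *m E = \row_j ('X^(j.+1) * E j j).
    apply/rowP => j; rewrite !mxE (bigD1 j) //= big1 ?addr0 ?mxE // => i /negPf ij.
    by rewrite mxE pencilE !mxE ij !mulr0n polyC0 mul0r addr0 mulr0.
  rewrite mxE; apply: eq_bigr => i _; rewrite [u^T _ _]mxE [u _ _]mxE mxE pencilE !mxE.
  rewrite eqxx !mulr1n /bump leq0n add1n -addnn exprD; ring.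
have -> : pencil (nfA e NA) (nfB e f NB) =
  block_mx (block_mx E L L^T 0) (block_mx 0 0 l^T 0) (block_mx 0 l 0 0)
    (block_mx (e`_1 *: 'X + (e`_0)%:P)%:M (map_mx polyC f) (map_mx polyC f)^T (pencil NA NB)).
  rewrite /nfA /nfB pencil_block; congr block_mx.
  - by rewrite pencil_block pencil0 /L tr_pencil linearN /= trmx1.
  - by rewrite -[X in pencil _ X]block_mx0 pencil_block !pencil0 /l tr_pencil trmx0.
  - by rewrite -[X in pencil _ X]block_mx0 pencil_block !pencil0.
  rewrite pencil_block; congr block_mx.
  - by apply/matrixP => i j; rewrite !ord1 pencilE !mxE eqxx !mulr1n mul_polyC.
  - by rewrite /pencil map_mx0 scaler0 add0r.
  - by rewrite /pencil map_mx0 scaler0 add0r map_trmx.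
by rewrite (det_bordered _ _ _ _ Lu uL) detL mulr1 uEu (det_border _ c0 wN).
Qed.
End NormalForm.

(** * Minimal kernel chains of a singular pencil *)

Section Chains.
Variable K : fieldType.

(** The conditions compare coefficients in
    (v_0 + v_1 'X + ... + v_k 'X^k) ('X A + B) = 0. *)
Definition chain d w (A B : 'M[K]_(d, w)) (k : nat) (v : nat -> 'rV[K]_d) :=
  [/\ v 0 *m B = 0, forall i, v i *m A + v i.+1 *m B = 0 & forall i, (k < i)%N -> v i = 0].

(** The hypothesis says that the linear system for v_0, ..., v_k has fewer
    equations, w (k + 2), than unknowns, d (k + 1). *)
Lemma chain_count d w k (A B : 'M[K]_(d, w)) : (w * k.+2 < d * k.+1)%N ->
  exists2 v, chain A B k v & exists i, v i != 0.
Proof.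
move=> lt_wd.
pose P1 : 'M[K]_(k.+2, k.+1) := \matrix_(i, j) (i == j.+1 :> nat)%:R.
pose P0 : 'M[K]_(k.+2, k.+1) := \matrix_(i, j) (i == j :> nat)%:R.
pose M := lin_mx (mulmxr A \o mulmx P1) + lin_mx (mulmxr B \o mulmx P0).
have /rowV0Pn[u /sub_kermxP uM u0] : kermx M != 0.
  rewrite -mxrank_eq0 mxrank_ker subn_eq0 -ltnNge.
  by rewrite (leq_ltn_trans (rank_leq_col _)) // mulnC [ltnRHS]mulnC.
have [Y uE] : exists Y, u = mxvec Y by exists (vec_mx u); rewrite vec_mxK.
pose v (i : nat) : 'rV_d := \row_c \sum_(j < k.+1 | i == j :> nat) Y j c.
have v_lt i : (k < i)%N -> v i = 0.
  move=> ki; apply/rowP => c; rewrite !mxE big_pred0 // => j.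
  by rewrite gtn_eqF // (leq_trans (ltn_ord j)).
have vE (j : 'I_k.+1) : v j = row j Y.
  apply/rowP => c; rewrite !mxE (big_pred1 j) //.
have P0E (i : 'I_k.+2) : row i (P0 *m Y) = v i.
  apply/rowP => c; rewrite !mxE [RHS]big_mkcond; apply: eq_bigr => j _.
  by rewrite mxE; case: eqP; rewrite ?mul1r ?mul0r.
have P1S (i : 'I_k.+1) : row (lift ord0 i) (P1 *m Y) = v i.
  apply/rowP => c; rewrite !mxE [RHS]big_mkcond; apply: eq_bigr => j _.
  by rewrite mxE /= eqSS; case: eqP; rewrite ?mul1r ?mul0r.
have P10 : row ord0 (P1 *m Y) = 0.
  by apply/rowP => c; rewrite !mxE big1 // => j _; rewrite mxE mul0r.
have MY : P1 *m Y *m A + P0 *m Y *m B = 0.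
  apply: (can_inj mxvecK); rewrite linearD /= linear0 -uM uE mulmxDr !mul_vec_lin.
  by [].
exists v; first split=> //.
- have := congr1 (row ord0) MY; rewrite linearD /= ![row _ (_ *m _ *m _)]row_mul P10 mul0mx add0r P0E row0.
  by [].
- move=> i; have [ik|ki] := ltnP i k.+1; last first.
    by rewrite (v_lt i) // (v_lt i.+1) ?mul0mx ?addr0 // ltnW.
  have := congr1 (row (lift ord0 (Ordinal ik))) MY.
  by rewrite linearD /= ![row _ (_ *m _ *m _)]row_mul P1S P0E row0.
have /matrix0Pn[i [j Yij]] : Y != 0 by rewrite -mxvec_eq0 -uE.
by exists i; rewrite vE; apply: contraNneq Yij => /rowP/(_ j); rewrite !mxE => ->.
Qed.

Lemma exists_chain n (A B : 'M[K]_n) : \det (pencil A B) = 0 ->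
  exists k v, chain A B k v /\ exists i, v i != 0.
Proof.
move=> /eqP/det0P[v v0 vN].
pose x i := map_mx (coefp i) v; pose k := (\max_j size (v 0%R j))%N.
exists k, x; split; last first.
  have /rV0Pn[j vj] := v0; exists (size (v 0 j)).-1.
  apply: contraNneq vj => /rowP/(_ j); rewrite !mxE /= => lc.
  by rewrite -lead_coef_eq0 lead_coefE lc.
have coef i j : ((v *m pencil A B) 0 j)`_i =
    (if i is i'.+1 then (x i' *m A) 0 j else 0) + (x i *m B) 0 j.
  have -> : v *m pencil A B = 'X *: (v *m map_mx polyC A) + v *m map_mx polyC B.
    by rewrite /pencil mulmxDr -scalemxAr.
  have cM (M : 'M[K]_n) l : ((v *m map_mx polyC M) 0 j)`_l = (x l *m M) 0 j.
    by rewrite !mxE coef_sum; apply: eq_bigr => l' _; rewrite !mxE coefMC.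
  by rewrite mxE [X in X + _]mxE coefD coefXM cM; case: i => [|i] //=; rewrite cM.
split.
- by apply/rowP => j; have := coef 0 j; rewrite vN !mxE coef0 add0r.
- by move=> i; apply/rowP => j; have := coef i.+1 j; rewrite vN mxE coef0 => e; rewrite mxE -e mxE.
- move=> i ki; apply/rowP => j; rewrite !mxE /= nth_default //.
  by rewrite (leq_trans _ (ltnW ki)) // (leq_bigmax j).
Qed.

(** Let d and w be the ranks of X = (v_0, ..., v_k) and of X A. The pencil maps
    the span of X into the span of X A, because v_(i+1) B = - v_i A, and w < d,
    because v_k A = 0. If the conclusion failed, chain_count for this restricted
    pencil would yield a chain of degree k - 1. *)
Lemma minimal_chain n (A B : 'M[K]_n) : \det (pencil A B) = 0 ->
  exists k v, [/\ chain A B k v, row_free (\matrix_(i < k.+1) v i)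
                & row_free (\matrix_(i < k) (v i *m A))].
Proof.
move=> dAB.
pose P k := exists2 v, chain A B k v & exists i, v i != 0.
have exP : exists k, `[< P k >].
  by have [k [v [cv v0]]] := exists_chain dAB; exists k; apply/asboolP; exists v.
have [k /asboolP[v [v0B vAB v_lt] [i0 vi0]] kmin] := ex_minnP exP.
have vAk : v k *m A = 0 by have := vAB k; rewrite (v_lt k.+1) // mul0mx addr0.
have vk0 : v k != 0.
  apply: contraTneq isT => vk; case: k => [|k] in kmin v_lt vAk vk *.
    case: i0 vi0 => [|i0]; first by rewrite vk eqxx.
    by rewrite v_lt ?eqxx.
  have : (k.+1 <= k)%N; last by rewrite ltnn.
  apply: kmin; apply/asboolP; exists v; last by exists i0.
  split=> // i; rewrite leq_eqVlt => /orP[/eqP <-//|]; exact: v_lt.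
pose X := \matrix_(i < k.+1) v i; pose W := X *m A.
have vX i : (v i <= X)%MS.
  have [ik|ki] := ltnP i k.+1; last by rewrite v_lt // sub0mx.
  by rewrite -[v i]/(v (Ordinal ik)) -(rowK (fun i : 'I_k.+1 => v i)) row_sub.
have XB : (X *m B <= W)%MS.
  apply/row_subP => i; rewrite row_mul rowK.
  case: (nat_of_ord i) => [|j]; first by rewrite v0B sub0mx.
  have /eqP := vAB j; rewrite addrC addr_eq0 => /eqP ->.
  by rewrite eqmx_opp submxMr.
have lt_w : (\rank W < \rank X)%N.
  rewrite -(mxrank_mul_ker X A) -[ltnLHS]addn0 ltn_add2l lt0n mxrank_eq0.
  apply: contra vk0 => /eqP cap0; rewrite -submx0 -cap0 sub_capmx vX.
  exact/sub_kermxP.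
have le_d : (\rank X <= k.+1)%N by apply: rank_leq_row.
have count : (\rank X * k <= \rank W * k.+1)%N.
  have [k0|k_gt0] := posnP k; first by rewrite [X in (_ * X)%N]k0 muln0.
  rewrite leqNgt; apply/negP => lt_wd.
  have /submxP[S SE] : (row_base X *m A <= row_base W)%MS.
    by rewrite eq_row_base submxMr // eq_row_base.
  have /submxP[T TE] : (row_base X *m B <= row_base W)%MS.
    by rewrite eq_row_base (submx_trans _ XB) // submxMr // eq_row_base.
  have [y [y0 yST y_lt] [i yi]] := @chain_count _ _ k.-1 S T ltac:(by rewrite prednK).
  have : (k <= k.-1)%N; last by rewrite leqNgt prednK ?leqnn.
  apply: kmin; apply/asboolP; exists (fun i => y i *m row_base X); last first.
    by exists i; rewrite mulmx_free_eq0 // row_base_free.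
  split=> [|j|j /y_lt ->]; last by rewrite mul0mx.
    by rewrite -mulmxA TE mulmxA y0 mul0mx.
  rewrite -(mulmxA (y j)) -(mulmxA (y j.+1)) SE TE.
  by rewrite (mulmxA _ S) (mulmxA _ T) -mulmxDl yST mul0mx.
(* With d <= k + 1 and w < d, the inequality d k <= w (k + 1) leaves no choice. *)
have [dE wE] : \rank X = k.+1 /\ \rank W = k by split; nia.
exists k, v; split=> //; first by rewrite /row_free -/X dE.
rewrite /row_free eqn_leq rank_leq_row /= -[leqLHS]wE mxrankS //.
apply/row_subP => i; rewrite row_mul rowK.
have := ltn_ord i; rewrite ltnS leq_eqVlt => /orP[/eqP ->|ik].
  by rewrite vAk sub0mx.
by rewrite -[v i *m A]/(v (Ordinal ik) *m A) -(rowK (fun i : 'I_k => v i *m A)) row_sub.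
Qed.

End Chains.

(** * Normal form of a singular symmetric pencil *)

(** The blocks, of sizes k, k, 1, m, correspond to v_1 .. v_k, to vectors dual to
    v_0 A .. v_(k-1) A, to v_0, and to a supplement. Placing v_0 third lets the
    determinant be computed by eliminating the first two blocks. *)
Definition singular_form (T : nmodType) k m (A1 : 'M[T]_k) (h : 'rV[T]_k) (L : 'M[T]_k)
    (C : 'M[T]_(k, m)) (N : 'M[T]_m) : 'M[_]_(k + k + (1 + m)) :=
  block_mx (block_mx 0 L L^T A1) (block_mx 0 0 h^T C)
           (block_mx 0 h 0 C^T) (block_mx 0 0 0 N).

Section SingularForm.
Variable K : fieldType.

(** v_i A v_j^T equals v_(i+1) A v_(j-1)^T; descending on j ends at v_0 B = 0. *)
Lemma chain_isotropic n k (A B : 'M[K]_n) v : A^T = A -> B^T = B -> chain A B k v ->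
  forall i j, v i *m A *m (v j)^T = 0.
Proof.
move=> symA symB [v0B vAB _] i j.
elim: j i => [|j IH] i.
  have -> : v i *m A = - (v i.+1 *m B) by apply/eqP; rewrite -addr_eq0 vAB.
  by rewrite mulNmx -mulmxA -symB -trmx_mul v0B trmx0 mulmx0 oppr0.
have -> : v i *m A = - (v i.+1 *m B) by apply/eqP; rewrite -addr_eq0 vAB.
have BE : v j.+1 *m B = - (v j *m A) by apply/eqP; rewrite -addr_eq0 addrC vAB.
by rewrite mulNmx -mulmxA -symB -trmx_mul BE linearN /= trmx_mul symA mulmxN mulmxA IH opprK.
Qed.

(** With Y the matrix of the rows v_i A (i < k), the v_i lie in the orthogonal Z
    of Y by isotropy. The last block of basis vectors spans a supplement of them
    in Z, and the second block is a right inverse of Y, transposed. *)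
Lemma singular_pencil_form n (A B : 'M[K]_n) :
    A^T = A -> B^T = B -> \det (pencil A B) = 0 ->
  exists k m (e : (k + k + (1 + m))%N = n) (Q : 'M[_]_(k + k + (1 + m), n)) A1 CA NA B1 CB NB,
    [/\ Q *m A *m Q^T = singular_form A1 (head_row K k) (shift_mx K k) CA NA,
        Q *m B *m Q^T = singular_form B1 0 (- 1%:M) CB NB,
        row_free Q, A1^T = A1 /\ B1^T = B1 & NA^T = NA /\ NB^T = NB].
Proof.
move=> symA symB dAB.
have [k [v [cv Xfree Yfree]]] := minimal_chain dAB.
have iso := chain_isotropic symA symB cv; case: cv => v0B vAB v_lt.
set Y := \matrix_(i < k) _ in Yfree.
pose X' := \matrix_(i < k) v i.+1.
have XE : \matrix_(i < k.+1) v i = col_mx (v 0%N) X' :> 'M[_]_(1 + k, n).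
  apply/row_matrixP => i; rewrite rowK; case: (split_ordP i) => j ->.
    by rewrite rowKu ord1 row_id.
  by rewrite rowKd rowK.
rewrite XE in Xfree; set X := col_mx _ _ in XE Xfree.
have vY (i : nat) : (i < k)%N -> exists j : 'I_k, i = j /\ v i *m A = row j Y.
  by move=> ik; exists (Ordinal ik); rewrite rowK.
have YX : Y *m X^T = 0.
  apply/row_matrixP => i; rewrite row_mul rowK row0; apply: trmx_inj.
  rewrite trmx_mul trmxK trmx0; apply/row_matrixP => j; rewrite row_mul row0.
  rewrite -XE rowK; apply: trmx_inj; rewrite trmx_mul trmxK trmx0; exact: iso.
have [YX0 YX'] : Y *m (v 0%N)^T = 0 /\ Y *m X'^T = 0.
  by move: YX; rewrite tr_col_mx mul_mx_row -[X in _ = X]row_mx0 => /eq_row_mx.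
have [Bt YBt] : exists Bt : 'M[_]_(n, k), Y *m Bt = 1%:M by apply/row_freeP.
pose Z := kermx Y^T.
have XZ : (X <= Z)%MS.
  by apply/sub_kermxP; apply: trmx_inj; rewrite trmx_mul trmxK YX trmx0.
have rZ : \rank Z = (n - k)%N by rewrite mxrank_ker mxrank_tr (eqnP Yfree).
have rX : \rank X = k.+1 by apply/eqnP.
have le_kn : (k <= n)%N by rewrite -(eqnP Yfree) rank_leq_col.
have leXZ : (k.+1 <= n - k)%N by rewrite -rX -rZ mxrankS.
pose m := (n - k - k.+1)%N.
have rC : \rank (Z :\: X)%MS = m.
  have := mxrank_cap_compl Z X; rewrite (capmx_idPr XZ) rX rZ /m => <-.
  by rewrite addKn.
have [C Cfree /eqmxP/andP[CS _]] := exists_row_basis rC.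
have CY : C *m Y^T = 0.
  by apply/sub_kermxP; apply: submx_trans CS (diffmxSl _ _).
have YC : Y *m C^T = 0 by apply: trmx_inj; rewrite trmx_mul trmxK CY trmx0.
have symYB : Bt^T *m Y^T = 1%:M by rewrite -trmx_mul YBt trmx1.
have X'A : X' *m A = shift_mx K k *m Y.
  apply/row_matrixP => i; rewrite !row_mul rowK.
  have [ik|ki] := ltnP i.+1 k.
    have [j [ij ->]] := vY _ ik; rewrite rowE; congr (_ *m _).
    by apply/rowP => l; rewrite !mxE eqxx /= -val_eqE /= -ij eq_sym.
  have -> : v i.+1 *m A = 0.
    have := vAB i.+1; rewrite (v_lt i.+2) // mul0mx addr0 //.
  rewrite (_ : row i _ = 0) ?mul0mx //; apply/rowP => l; rewrite !mxE.
  by rewrite gtn_eqF // (leq_trans (ltn_ord l)).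
have X0A : v 0%N *m A = head_row K k *m Y.
  have [k0|k_gt0] := posnP k.
    have -> : v 0%N *m A = 0.
      by have := vAB 0%N; rewrite (v_lt 1%N) ?mul0mx ?addr0 // k0.
    rewrite (_ : head_row K k = 0) ?mul0mx //.
    by apply/rowP => l; have := ltn_ord l; rewrite [X in (_ < X)%N]k0.
  have [j [ij ->]] := vY _ k_gt0; rewrite rowE; congr (_ *m _).
  by apply/rowP => l; rewrite !mxE eqxx /= -val_eqE /= -ij.
have X'B : X' *m B = - Y.
  apply/row_matrixP => i; rewrite row_mul linearN /= !rowK.
  by apply/eqP; rewrite -addr_eq0 addrC vAB.
have e : (k + k + (1 + m))%N = n by rewrite /m; lia.
pose Q := col_mx (col_mx X' Bt^T) (col_mx (v 0%N) C).
pose b := Bt^T.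
exists k, m, e, Q, (b *m A *m b^T), (b *m A *m C^T), (C *m A *m C^T).
exists (b *m B *m b^T), (b *m B *m C^T), (C *m B *m C^T).
split.
- have b_X' : b *m A *m X'^T = (shift_mx K k)^T.
    apply: trmx_inj; rewrite !trmx_mul !trmxK symA mulmxA X'A -mulmxA YBt.
    by rewrite mulmx1.
  have C_X' : C *m A *m X'^T = 0.
    by apply: trmx_inj; rewrite !trmx_mul !trmxK symA mulmxA X'A -mulmxA YC mulmx0 trmx0.
  have b_X0 : b *m A *m (v 0%N)^T = (head_row K k)^T.
    apply: trmx_inj; rewrite !trmx_mul !trmxK symA mulmxA X0A -mulmxA YBt.
    by rewrite mulmx1.
  have C_X0 : C *m A *m (v 0%N)^T = 0.
    by apply: trmx_inj; rewrite !trmx_mul !trmxK symA mulmxA X0A -mulmxA YC mulmx0 trmx0.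
  have C_b : C *m A *m b^T = (b *m A *m C^T)^T.
    by rewrite !trmx_mul !trmxK symA mulmxA.
  have -> : Q *m A = col_mx (col_mx (X' *m A) (b *m A)) (col_mx (v 0%N *m A) (C *m A)).
    by rewrite /Q -/b !mul_col_mx.
  rewrite /Q -/b !tr_col_mx !mul_col_row.
  rewrite b_X' C_X' b_X0 C_X0 C_b X'A X0A -!mulmxA YX' YX0 YC /b trmxK YBt !mulmx0 !mulmx1.
  by [].
- have X0B : v 0%N *m B = 0 by [].
  have b_X' : b *m B *m X'^T = - 1%:M.
    apply: trmx_inj; rewrite !trmx_mul !trmxK symB mulmxA X'B mulNmx YBt.
    by rewrite linearN /= trmx1.
  have C_X' : C *m B *m X'^T = 0.
    by apply: trmx_inj; rewrite !trmx_mul !trmxK symB mulmxA X'B mulNmx YC oppr0 trmx0.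
  have b_X0 : b *m B *m (v 0%N)^T = 0.
    by apply: trmx_inj; rewrite !trmx_mul !trmxK symB mulmxA X0B mul0mx trmx0.
  have C_X0 : C *m B *m (v 0%N)^T = 0.
    by apply: trmx_inj; rewrite !trmx_mul !trmxK symB mulmxA X0B mul0mx trmx0.
  have C_b : C *m B *m b^T = (b *m B *m C^T)^T.
    by rewrite !trmx_mul !trmxK symB mulmxA.
  have -> : Q *m B = col_mx (col_mx (X' *m B) (b *m B)) (col_mx (v 0%N *m B) (C *m B)).
    by rewrite /Q -/b !mul_col_mx.
  rewrite /Q -/b !tr_col_mx !mul_col_row.
  rewrite b_X' C_X' b_X0 C_X0 C_b X'B X0B !mulNmx !mul0mx YX' YX0 YC /b trmxK YBt !oppr0.
  by rewrite /singular_form trmx0 linearN /= trmx1.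
- apply/inj_row_free => x; rewrite -[x]hsubmxK -[lsubmx x]hsubmxK -[rsubmx x]hsubmxK.
  set a1 := lsubmx (lsubmx x); set a2 := rsubmx (lsubmx x).
  set a3 := lsubmx (rsubmx x); set a4 := rsubmx (rsubmx x).
  rewrite /Q !mul_row_col => xQ.
  have a2_0 : a2 = 0.
    have := congr1 (mulmx^~ Y^T) xQ; rewrite mul0mx !mulmxDl -!mulmxA symYB CY.
    have -> : X' *m Y^T = 0 by apply: trmx_inj; rewrite trmx_mul trmxK YX' trmx0.
    have -> : v 0%N *m Y^T = 0 by apply: trmx_inj; rewrite trmx_mul trmxK YX0 trmx0.
    by rewrite !mulmx0 mulmx1 add0r !addr0.
  have XC : row_mx a3 a1 *m X = - (a4 *m C).
    apply/eqP; rewrite -addr_eq0 mul_row_col; move: xQ; rewrite a2_0 mul0mx addr0.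
    by rewrite addrA [a1 *m _ + _]addrC => ->.
  have a4_0 : a4 = 0.
    apply/eqP; rewrite -(mulmx_free_eq0 _ Cfree) -oppr_eq0 -XC.
    rewrite -submx0 -(capmx_diff Z X) sub_capmx submxMl andbT XC eqmx_opp.
    exact: submx_trans (submxMl _ _) CS.
  have /eqP : row_mx a3 a1 = 0.
    by apply/eqP; rewrite -(mulmx_free_eq0 _ Xfree) XC a4_0 mul0mx oppr0.
  rewrite row_mx_eq0 => /andP[/eqP-> /eqP->].
  by rewrite a2_0 a4_0 !row_mx0.
- by rewrite !trmx_mul !trmxK symA symB !mulmxA.
- by rewrite !trmx_mul !trmxK symA symB !mulmxA.
Qed.
End SingularForm.

(** * Perturbations and real-rooted pencils *)

Section DistinctRoots.
Variable R : fieldType.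

(** Kernel vectors z_i, z_j at distinct roots are orthogonal for A and B since
    r_i z_i A z_j^T = - z_i B z_j^T = r_j z_i A z_j^T. They are independent as
    eigenvectors of B A^-1 for distinct eigenvalues. *)
Lemma distinct_roots_basis n (A B : 'M[R]_n) (r : 'I_n -> R) :
    A^T = A -> B^T = B -> \det A != 0 -> injective r ->
    (forall i, root (\det (pencil A B)) (r i)) ->
  exists2 Z : 'M[R]_n, Z \in unitmx &
    is_diag_mx (Z *m A *m Z^T) && is_diag_mx (Z *m B *m Z^T).
Proof.
move=> symA symB dA r_inj r_root.
have /fin_all_exists2[z z0 zN] (i : 'I_n) :
    exists2 z : 'rV_n, z != 0 & z *m (r i *: A + B) = 0.
  by apply/det0P; rewrite -det_pencil_horner; exact: r_root.
pose Z := \matrix_i z i; pose D := diag_mx (\row_i r i).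
have ZB : Z *m B = - (D *m Z *m A).
  apply/row_matrixP => i; rewrite linearN /= !row_mul row_diag_mx rowK mxE.
  rewrite -scalemxAl -rowE rowK -scalemxAl scalemxAr.
  by apply/eqP; rewrite -addr_eq0 addrC -mulmxDr zN.
have Au : A \in unitmx by rewrite unitmxE unitfE.
have DZ : D *m Z = - (Z *m B *m invmx A) by rewrite ZB mulNmx opprK mulmxK.
have Zu : Z \in unitmx.
  rewrite -row_free_unit; apply/inj_row_free => x xZ.
  (* The relations killing Z are stable under D, hence under p(D); for p a
     Lagrange polynomial this isolates one coordinate of x. *)
  have xp (p : {poly R}) : (\row_i (x 0 i * p.[r i])) *m Z = 0.
    elim/poly_ind: p => [|p c IH].
      by rewrite (_ : \row__ _ = 0) ?mul0mx //; apply/rowP => i; rewrite !mxE horner0 mulr0.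
    have -> : \row_i (x 0 i * (p * 'X + c%:P).[r i]) =
        (\row_i (x 0 i * p.[r i])) *m D + c *: x.
      by apply/rowP => i; rewrite mul_mx_diag !mxE !hornerE mulrDr mulrA [c * _]mulrC.
    rewrite mulmxDl -scalemxAl xZ scaler0 addr0 -mulmxA DZ -[Z *m B *m _]mulmxA.
    by rewrite mulmxN (mulmxA _ Z) IH mul0mx oppr0.
  apply/rowP => i; rewrite mxE; apply/eqP.
  have /eqP := xp (\prod_(j | j != i) ('X - (r j)%:P)).
  rewrite mulmx_sum_row (bigD1 i) //= [X in _ + X]big1 ?addr0 => [|j ji]; last first.
    rewrite mxE [X in _ * X](_ : _ = 0) ?mulr0 ?scale0r //.
    rewrite horner_prod; apply/eqP/prodf_eq0; exists j => //.
    by rewrite !hornerE subrr.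
  rewrite scaler_eq0 rowK (negPf (z0 i)) orbF mxE mulf_eq0 => /orP[//|].
  rewrite horner_prod prodf_seq_eq0 => /hasP[j _ /andP[ji]].
  by rewrite !hornerE subr_eq0 => /eqP/r_inj ij; rewrite ij eqxx in ji.
pose S := Z *m A *m Z^T.
have symS : S^T = S by rewrite /S !trmx_mul trmxK symA mulmxA.
have ZBZ : Z *m B *m Z^T = - (D *m S) by rewrite ZB mulNmx /S !mulmxA.
have symDS : (D *m S)^T = D *m S.
  by apply: oppr_inj; rewrite -linearN /= -ZBZ !trmx_mul trmxK symB mulmxA.
have S_diag : is_diag_mx S.
  apply/is_diag_mxP => i j ij; apply/eqP.
  have DSE a b : (D *m S) a b = r a * S a b by rewrite mul_diag_mx !mxE.
  have Sji : S j i = S i j by rewrite -{1}symS mxE.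
  have : r j * S i j = r i * S i j by rewrite -{1}Sji -!DSE -{1}symDS mxE.
  move/eqP; rewrite -subr_eq0 -mulrBl mulf_eq0 subr_eq0 => /orP[/eqP/r_inj ji|//].
  by rewrite ji eqxx in ij.
exists Z => //; rewrite -/S S_diag ZBZ; apply/is_diag_mxP => i j ij.
rewrite mxE mul_diag_mx mxE (is_diag_mxP S_diag) ?mulr0 ?oppr0 //.
Qed.

End DistinctRoots.

Section Limits.
Variable R : realType.

Lemma near0_ex (P : set R) : (\forall t \near 0^'+, P t) -> exists t, P t.
Proof. exact: (@filter_ex _ (at_right (0 : R))). Qed.

Lemma poly_pos_near (p : {poly R}) : 0 < p.[0] -> \forall t \near 0^'+, 0 < p.[t].
Proof.
move=> p0; have : p.[t] @[t --> 0^'+] --> p.[0].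
  by apply: cvg_at_right_filter; exact: continuous_horner.
by move/cvgr_gt; apply.
Qed.

Lemma poly_neq0_near (p : {poly R}) : p != 0 -> \forall t \near 0^'+, p.[t] != 0.
Proof.
move=> p0; have [k [q q0 pE]] := multiplicity_XsubC p 0.
rewrite p0 /= in q0.
have qq0 : 0 < (q * q).[0].
  by rewrite hornerM -expr2 lt0r sqr_ge0 andbT sqrf_eq0; exact: q0.
near=> t.
have t0 : 0 < t by near: t; exact: nbhs_right_gt.
have : 0 < (q * q).[t] by near: t; exact: poly_pos_near.
rewrite hornerM -expr2 exprn_even_gt0 //= => qt.
by rewrite pE hornerM mulf_neq0 // horner_exp hornerXsubC subr0 expf_neq0 // gt_eqF.
Unshelve. all: by end_near. Qed.

(** The point at time t of a polynomial path of matrices. *)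
Definition ev n (t : R) (P : 'M[{poly R}]_n) : 'M[R]_n := map_mx (horner_eval t) P.

Definition near_SDC n (A B : 'M[R]_n) := forall e : R, 0 < e -> exists A' B',
  [/\ A'^T = A', B'^T = B', SDC [set A'; B'],
      forall i j, `|A i j - A' i j| < e & forall i j, `|B i j - B' i j| < e].

Lemma ev_near n (P : 'M[{poly R}]_n) e : 0 < e ->
  \forall t \near 0^'+, forall i j, `|ev 0 P i j - ev t P i j| < e.
Proof.
move=> e0; apply: filter_forall => i; apply: filter_forall => j.
have : (P i j).[t] @[t --> 0^'+] --> (P i j).[0].
  by apply: cvg_at_right_filter; exact: continuous_horner.
move/cvgrPdist_lt => /(_ _ e0).
by apply: filterS => t; rewrite !mxE.
Qed.

(** The limits of SDC pairs form a closed set. *)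
Lemma near_SDC_path n (PA PB : 'M[{poly R}]_n) :
    (\forall t \near 0^'+, near_SDC (ev t PA) (ev t PB)) ->
  near_SDC (ev 0 PA) (ev 0 PB).
Proof.
move=> H e e0; have e2 : 0 < e / 2 by rewrite divr_gt0.
have ex : \forall t \near 0^'+,
    ((forall i j, `|ev 0 PA i j - ev t PA i j| < e / 2) /\
     (forall i j, `|ev 0 PB i j - ev t PB i j| < e / 2)) /\
    near_SDC (ev t PA) (ev t PB).
  by apply: filterI => //; apply: filterI; exact: ev_near.
have [t [[tA tB] Ht]] := near0_ex ex.
have [A' [B' [symA' symB' sdc AA' BB']]] := Ht _ e2.
exists A', B'; split=> // i j.
  by rewrite (splitr e) (le_lt_trans (ler_distD (ev t PA i j) _ _)) // ltrD.
by rewrite (splitr e) (le_lt_trans (ler_distD (ev t PB i j) _ _)) // ltrD.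
Qed.

Lemma SDC_near n (A B : 'M[R]_n) : A^T = A -> B^T = B -> SDC [set A; B] -> near_SDC A B.
Proof. by move=> symA symB sdc e e0; exists A, B; split=> // i j; rewrite subrr normr0. Qed.

Lemma SDC_congr n (Q A B : 'M[R]_n) : Q \in unitmx -> SDC [set A; B] ->
  SDC [set Q *m A *m Q^T; Q *m B *m Q^T].
Proof.
move=> Qu [P Pu PD]; exists (invmx Q^T *m P).
  by rewrite unitmx_mul unitmx_inv unitmx_tr Qu.
have E X : (invmx Q^T *m P)^T *m (Q *m X *m Q^T) *m (invmx Q^T *m P) = P^T *m X *m P.
  rewrite trmx_mul trmx_inv trmxK !mulmxA mulmxKV // -(mulmxA _ Q^T) mulmxV ?unitmx_tr //.
  by rewrite mulmx1.
by move=> _ [->|->]; rewrite E; apply: PD; [left|right].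
Qed.

Lemma distinct_roots_SDC n (A B : 'M[R]_n) (r : 'I_n -> R) :
    A^T = A -> B^T = B -> \det A != 0 -> injective r ->
    (forall i, root (\det (pencil A B)) (r i)) -> SDC [set A; B].
Proof.
move=> symA symB dA r_inj r_root.
have [Z Zu /andP[ZA ZB]] := distinct_roots_basis symA symB dA r_inj r_root.
exists Z^T; first by rewrite unitmx_tr.
by move=> _ [->|->]; rewrite trmxK.
Qed.

Lemma simple_root_sign_change (p q : {poly R}) r : p = ('X - r%:P) * q -> ~~ root q r ->
  \forall e \near 0^'+, p.[r - e] * p.[r + e] < 0.
Proof.
move=> pE qr; pose h := (q \Po (r%:P - 'X)) * (q \Po (r%:P + 'X)).
have h0 : 0 < h.[0].
  rewrite hornerM !horner_comp !hornerE ?subr0 ?addr0 -expr2.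
  by rewrite lt0r sqr_ge0 andbT sqrf_eq0; exact: qr.
near=> e.
have e0 : 0 < e by near: e; exact: nbhs_right_gt.
have : 0 < h.[e] by near: e; exact: poly_pos_near.
have -> : p.[r - e] = - e * q.[r - e].
  by rewrite pE hornerM hornerXsubC addrAC subrr sub0r.
have -> : p.[r + e] = e * q.[r + e].
  by rewrite pE hornerM hornerXsubC addrAC subrr add0r.
have -> : h.[e] = q.[r - e] * q.[r + e].
  by rewrite /h hornerM !horner_comp !hornerE.
move=> he; rewrite mulrACA !mulNr.
by rewrite oppr_lt0 mulr_gt0 // mulr_gt0.
Unshelve. all: by end_near. Qed.

(** Fix e so small that the intervals of radius e around the roots are disjoint
    and the determinant changes sign on each. The finitely many endpoint values
    are polynomials in t, so that the sign changes remain for small t, and each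
    interval still contains a root. *)
Lemma distinct_roots_persist n (PA PB : 'M[{poly R}]_n) (c : R) (r : 'I_n -> R) :
    (forall t, (ev t PA)^T = ev t PA) -> (forall t, (ev t PB)^T = ev t PB) ->
    \det (ev 0 PA) != 0 -> injective r -> c != 0 ->
    \det (pencil (ev 0 PA) (ev 0 PB)) = c *: \prod_i ('X - (r i)%:P) ->
  \forall t \near 0^'+, SDC [set ev t PA; ev t PB].
Proof.
move=> symA symB dA r_inj c0 detE; set p := \det _ in detE.
have sgn_near : \forall e \near 0^'+, forall i, p.[r i - e] * p.[r i + e] < 0.
  apply: filter_forall => i.
  apply: (@simple_root_sign_change _ (c *: \prod_(j | j != i) ('X - (r j)%:P))).
    by rewrite detE (bigD1 i) //= -scalerAr.
  rewrite rootZ // /root horner_prod; apply/prodf_neq0 => j ji.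
  by rewrite !hornerE subr_eq0; apply: contra ji => /eqP/r_inj ->.
have sep_near : \forall e \near 0^'+, forall i j, i != j -> e < `|r i - r j| / 2.
  apply: filter_forall => i; apply: filter_forall => j.
  have [->|ij] := eqVneq i j; first by near=> e.
  near=> e => _; near: e; apply: nbhs_right_lt.
  by rewrite divr_gt0 // normr_gt0 subr_eq0; apply: contra ij => /eqP/r_inj ->.
have /near0_ex[e [e0 sgn sep]] : \forall e \near 0^'+, [/\ 0 < e,
    forall i, p.[r i - e] * p.[r i + e] < 0 &
    forall i j, i != j -> e < `|r i - r j| / 2].
  by near=> e; split; near: e => //; exact: nbhs_right_gt.
pose g x := \det (x%:P *: PA + PB).
have gE t x : (g x).[t] = (\det (pencil (ev t PA) (ev t PB))).[x].
  rewrite det_pencil_horner -[LHS]/(horner_eval t _) -det_map_mx; congr (\det _).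
  by apply/matrixP => i j; rewrite !mxE rmorphD rmorphM /= /horner_eval hornerC.
near=> t.
have dAt : \det (ev t PA) != 0.
  have -> : \det (ev t PA) = (\det PA).[t] by rewrite /ev det_map_mx.
  near: t; apply: poly_neq0_near; apply: contra dA => /eqP dPA.
  by rewrite /ev det_map_mx dPA rmorph0.
have sgn_t i : (g (r i - e)).[t] * (g (r i + e)).[t] < 0.
  move: i; near: t; apply: filter_forall => i.
  have : 0 < (- (g (r i - e) * g (r i + e))).[0].
    by rewrite hornerN hornerM !gE oppr_gt0.
  by move/poly_pos_near; apply: filterS => t; rewrite hornerN hornerM oppr_gt0.
have /fin_all_exists2[y y_in y_root] (i : 'I_n) : exists2 y,
    y \in `]r i - e, r i + e[ & root (\det (pencil (ev t PA) (ev t PB))) y.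
  have le : r i - e <= r i + e by lra.
  have [|y] := @poly_ivtoo _ (\det (pencil (ev t PA) (ev t PB))) _ _ le.
    by rewrite -!gE.
  by exists y.
apply: (@distinct_roots_SDC _ _ _ y) => // i j yij.
apply/eqP; apply: contraT => /sep; have := y_in i; have := y_in j.
rewrite !in_itv /= yij => /andP[a1 a2] /andP[b1 b2].
by case: (lerP 0 (r i - r j)) => [/ger0_norm|/ltr0_norm] ->; lra.
Unshelve. all: by end_near. Qed.

End Limits.

(** * Perturbing the normal form *)

Section Assembly.
Variable R : realType.

Lemma complete_distinct (rs : seq R) n : uniq rs -> (size rs <= n)%N ->
  exists ss, uniq (rs ++ ss) /\ size (rs ++ ss) = n.
Proof.
move=> rs_uniq le_n; pose M := \sum_(r <- rs) `|r| + 1.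
have ltM r : r \in rs -> r < M.
  move=> r_in; rewrite (le_lt_trans (ler_norm r)) // /M (big_rem r) //= -addrA.
  by rewrite ltrDl ltr_wpDl // sumr_ge0.
exists [seq M + i%:R | i <- iota 0 (n - size rs)]; split; last first.
  by rewrite size_cat size_map size_iota subnKC.
rewrite cat_uniq rs_uniq /= map_inj_uniq ?iota_uniq ?andbT; last first.
  by move=> i j /addrI/eqP; rewrite eqr_nat => /eqP.
apply/hasPn => _ /mapP[i _ ->]; apply/negP => /ltM.
by rewrite ltNge lerDl ler0n.
Qed.

(** The target polynomial p is h times linear factors with new real roots; the
    residue of f adj(N) f^T being that of - p, the quotient e of p + f adj(N) f^T
    by det N exists, and a degree count makes it small enough for det_nf. *)
Lemma nf_distinct_roots k m (NA NB : 'M[R]_m) : \det NA != 0 -> realisable NA NB ->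
  exists (e : {poly R}) (f : 'rV[R]_m) (c : R) (r : 'I_(k + k + (1 + m)) -> R),
    [/\ injective r, c != 0, \det (nfA k e NA) != 0 &
      \det (pencil (nfA k e NA) (nfB k e f NB)) = c *: \prod_i ('X - (r i)%:P)].
Proof.
move=> dNA [rs []]; set h := \prod_(r <- rs) _ => rs_uniq hc at_h.
set n := (k + k + (1 + m))%N.
have [_ szc] := lead_coef_det_pencil NB dNA.
set C := \det (pencil NA NB) in hc szc.
have C0 : C != 0 by rewrite -size_poly_eq0 szc.
have le_rs : (size rs <= m)%N.
  by have := dvdp_leq C0 hc; rewrite size_prod_XsubC szc ltnS.
have [ss [s_uniq s_size]] : exists ss, uniq (rs ++ ss) /\ size (rs ++ ss) = n.
  apply: complete_distinct => //; apply: (leq_trans le_rs); rewrite /n; lia.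
set s := rs ++ ss in s_uniq s_size.
have [f [w [wN]]] := at_h (\prod_(r <- ss) ('X - r%:P)).
rewrite -/C in wN *; rewrite -big_cat -/s /=; set p := \prod_(r <- s) _.
have szp : size p = n.+1 by rewrite size_prod_XsubC s_size.
set wf := _ 0 0 => /dvdpP[e eE].
have szwf : (size wf <= m)%N.
  have wE : w = map_mx polyC f *m \adj (pencil NA NB).
    apply: (scalemx_inj C0); rewrite scalemxAl -wN -mulmxA mul_mx_adj.
    by rewrite mul_mx_scalar.
  rewrite /wf mxE (leq_trans (size_sum _ _ _)) //; apply/bigmax_leqP => j _.
  rewrite !mxE mulrC mul_polyC (leq_trans (size_scale_leq _ _)) //.
  rewrite wE mxE (leq_trans (size_sum _ _ _)) //; apply/bigmax_leqP => l _.
  rewrite mxE mul_polyC (leq_trans (size_scale_leq _ _)) //.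
  exact: size_adj_pencil.
have sze : (size e <= k.+1.*2)%N.
  have [->|e0] := eqVneq e 0; first by rewrite size_poly0.
  have : (size (e * C)%R <= n.+1)%N.
    by rewrite -eE (leq_trans (size_polyD _ _)) // geq_max szp leqnn andbT (leq_trans szwf) // /n; lia.
  by rewrite size_mul // szc /n -!muln2; set z := size _; lia.
have detE := det_nf sze C0 wN; rewrite -/C -/wf -eE addrC addKr in detE.
pose r (i : 'I_n) := nth 0 s i.
have pE : p = \prod_i ('X - (r i)%:P).
  by rewrite /p (big_nth 0) s_size big_mkord.
pose c := swap_det R k.
have cE : swap_det {poly R} k = c%:P.
  rewrite /swap_det /c /swap_det -det_map_mx map_block_mx !map_mx0 map_mx1.
  by [].
have c0 : c != 0.
  by apply/eqP => c0; have /eqP := swap_det_sqr R k; rewrite -/c c0 mul0r eq_sym oner_eq0.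
have detE' : \det (pencil (nfA k e NA) (nfB k e f NB)) = c *: p.
  by rewrite detE cE mul_polyC.
exists e, f, c, r; split=> //; last by rewrite detE' pE.
- move=> i j /eqP; rewrite nth_uniq ?s_size // => /eqP; exact: val_inj.
rewrite -(coef_det_pencil _ (nfB k e f NB)) detE' coefZ mulf_neq0 //.
have : lead_coef p = 1 by apply/monicP/monic_prod_XsubC.
by rewrite lead_coefE szp => ->; rewrite oner_neq0.
Qed.

(** PA, PB is the path that starts at the pencil with distinct real roots; OA,
    OB is the path that starts at the given singular form. For t > 0 the two are
    congruent through D = diag (t, 1/t, t, 1). *)
Lemma near_SDC_of_generic k m (Q : 'M[R]_(k + k + (1 + m))) A1 CA NA B1 CB NB :
    Q \in unitmx -> A1^T = A1 -> B1^T = B1 -> NA^T = NA -> NB^T = NB ->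
    \det NA != 0 -> realisable NA NB ->
  near_SDC (Q *m singular_form A1 (head_row R k) (shift_mx R k) CA NA *m Q^T)
           (Q *m singular_form B1 0 (- 1%:M) CB NB *m Q^T).
Proof.
move=> Qu symA1 symB1 symNA symNB dNA real.
have [e [f [c [r [r_inj c0 dA detE]]]]] := nf_distinct_roots k dNA real.
pose EA : 'M[R]_k := diag_mx (\row_i e`_(i.+1.*2.+1)).
pose EB : 'M[R]_k := diag_mx (\row_i e`_(i.+1.*2)).
pose S := shift_mx R k; pose h := head_row R k.
pose C p q (M : 'M[R]_(p, q)) := map_mx polyC M.
pose PA : 'M[{poly R}]_(k + k + (1 + m)) :=
  block_mx (block_mx (C _ _ EA) (C _ _ S) (C _ _ S^T) ('X^2 *: C _ _ A1))
           (block_mx 0 0 (C _ _ h^T) ('X *: C _ _ CA))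
           (block_mx 0 (C _ _ h) 0 ('X *: C _ _ CA^T))
           (block_mx (C _ _ (e`_1)%:M) 0 0 (C _ _ NA)).
pose PB : 'M[{poly R}]_(k + k + (1 + m)) :=
  block_mx (block_mx (C _ _ EB) (C _ _ (- 1%:M)) (C _ _ (- 1%:M)) ('X^2 *: C _ _ B1))
           (block_mx 0 0 0 ('X *: C _ _ CB))
           (block_mx 0 0 0 ('X *: C _ _ CB^T))
           (block_mx (C _ _ (e`_0)%:M) (C _ _ f) (C _ _ f^T) (C _ _ NB)).
pose OA : 'M[{poly R}]_(k + k + (1 + m)) :=
  block_mx (block_mx ('X^2 *: C _ _ EA) (C _ _ S) (C _ _ S^T) (C _ _ A1))
           (block_mx 0 0 (C _ _ h^T) (C _ _ CA))
           (block_mx 0 (C _ _ h) 0 (C _ _ CA^T))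
           (block_mx ('X^2 *: C _ _ (e`_1)%:M) 0 0 (C _ _ NA)).
pose OB : 'M[{poly R}]_(k + k + (1 + m)) :=
  block_mx (block_mx ('X^2 *: C _ _ EB) (C _ _ (- 1%:M)) (C _ _ (- 1%:M)) (C _ _ B1))
           (block_mx 0 0 0 (C _ _ CB))
           (block_mx 0 0 0 (C _ _ CB^T))
           (block_mx ('X^2 *: C _ _ (e`_0)%:M) ('X *: C _ _ f) ('X *: C _ _ f^T) (C _ _ NB)).
have evC p q (M : 'M[R]_(p, q)) t : map_mx (horner_eval t) (C _ _ M) = M.
  by apply/matrixP => i j; rewrite !mxE /horner_eval hornerC.
have evXC p q (M : 'M[R]_(p, q)) t : map_mx (horner_eval t) ('X *: C _ _ M) = t *: M.
  by apply/matrixP => i j; rewrite !mxE /= /horner_eval hornerM hornerX hornerC.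
have evX2C p q (M : 'M[R]_(p, q)) t : map_mx (horner_eval t) ('X^2 *: C _ _ M) = t ^+ 2 *: M.
  by apply/matrixP => i j; rewrite !mxE /= /horner_eval hornerM hornerXn hornerC.
have evE := (evC, evXC, evX2C, map_mx0).
have evPA t : ev t PA = block_mx (block_mx EA S S^T (t ^+ 2 *: A1)) (block_mx 0 0 h^T (t *: CA))
    (block_mx 0 h 0 (t *: CA^T)) (block_mx (e`_1)%:M 0 0 NA).
  by rewrite /ev /PA !map_block_mx !evE.
have evPB t : ev t PB = block_mx (block_mx EB (- 1%:M) (- 1%:M) (t ^+ 2 *: B1))
    (block_mx 0 0 0 (t *: CB)) (block_mx 0 0 0 (t *: CB^T)) (block_mx (e`_0)%:M f f^T NB).
  by rewrite /ev /PB !map_block_mx !evE.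
have evOA t : ev t OA = block_mx (block_mx (t ^+ 2 *: EA) S S^T A1) (block_mx 0 0 h^T CA)
    (block_mx 0 h 0 CA^T) (block_mx (t ^+ 2 *: (e`_1)%:M) 0 0 NA).
  by rewrite /ev /OA !map_block_mx !evE.
have evOB t : ev t OB = block_mx (block_mx (t ^+ 2 *: EB) (- 1%:M) (- 1%:M) B1)
    (block_mx 0 0 0 CB) (block_mx 0 0 0 CB^T)
    (block_mx (t ^+ 2 *: (e`_0)%:M) (t *: f) (t *: f^T) NB).
  by rewrite /ev /OB !map_block_mx !evE.
have symPA t : (ev t PA)^T = ev t PA.
  rewrite evPA !tr_block_mx !trmx0 !linearZ /= !trmxK tr_diag_mx tr_scalar_mx.
  by rewrite symA1 symNA.
have symPB t : (ev t PB)^T = ev t PB.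
  rewrite evPB !tr_block_mx !trmx0 !linearZ /= !trmxK tr_diag_mx !linearN /= !tr_scalar_mx.
  by rewrite symB1 symNB.
have symOA t : (ev t OA)^T = ev t OA.
  rewrite evOA !tr_block_mx !trmx0 !linearZ /= !trmxK tr_diag_mx tr_scalar_mx.
  by rewrite symA1 symNA.
have symOB t : (ev t OB)^T = ev t OB.
  rewrite evOB !tr_block_mx !trmx0 !linearZ /= !trmxK tr_diag_mx !linearN /= !tr_scalar_mx.
  by rewrite symB1 symNB.
have PA0 : ev 0 PA = nfA k e NA by rewrite evPA expr0n /= !scale0r.
have PB0 : ev 0 PB = nfB k e f NB by rewrite evPB expr0n /= !scale0r !block_mx0.
have sdcP : \forall t \near 0^'+, SDC [set ev t PA; ev t PB].
  by apply: (distinct_roots_persist symPA symPB _ r_inj c0); rewrite PA0 ?PB0.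
have -> : singular_form A1 (head_row R k) (shift_mx R k) CA NA = ev 0 OA.
  by rewrite evOA expr0n /= !scale0r.
have -> : singular_form B1 0 (- 1%:M) CB NB = ev 0 OB.
  by rewrite evOB expr0n /= !scale0r /singular_form trmx0 linearN /= trmx1.
pose QC := C _ _ Q.
have evQ t (M : 'M[{poly R}]_(k + k + (1 + m))) : ev t (QC *m M *m QC^T) = Q *m ev t M *m Q^T.
  by rewrite /ev !map_mxM -map_trmx evC.
rewrite -!evQ; apply: near_SDC_path; near=> t.
rewrite !evQ; have t0 : 0 < t by near: t; exact: nbhs_right_gt.
have tN0 : t != 0 by rewrite gt_eqF.
apply: SDC_near.
- by rewrite !trmx_mul trmxK symOA mulmxA.
- by rewrite !trmx_mul trmxK symOB mulmxA.
apply: SDC_congr => //.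
pose D : 'M[R]_(k + k + (1 + m)) := block_mx (block_mx t%:M 0 0 (t^-1)%:M) 0 0 (block_mx t%:M 0 0 1%:M).
have Dt : D^T = D by rewrite /D !tr_block_mx !trmx0 !tr_scalar_mx.
have Du : D \in unitmx.
  by rewrite unitmxE unitfE /D !det_ublock !det_scalar !mulf_neq0 ?expf_neq0 ?invr_eq0 // oner_neq0.
have blockE := (mulmx_block, mulmx0, mul0mx, addr0, add0r, mul_scalar_mx, mul_mx_scalar).
have DPA : ev t OA = D *m ev t PA *m D^T.
  rewrite Dt evPA evOA /D !blockE !scalerA !scaler0 expr2.
  by rewrite !(mulfV tN0, mulVf tN0, mulr1, mul1r, mulKf tN0, scale1r).
have DPB : ev t OB = D *m ev t PB *m D^T.
  rewrite Dt evPB evOB /D !blockE !scalerA !scaler0 expr2.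
  by rewrite !(mulfV tN0, mulVf tN0, mulr1, mul1r, mulKf tN0, scale1r).
rewrite DPA DPB; apply: SDC_congr => //; near: t; exact: sdcP.
Unshelve. all: by end_near. Qed.

End Assembly.

(** * Passage to the limit *)

Section Main.
Variable R : realType.

Lemma near_SDC_of_singular n (A B : 'M[R]_n) :
  A^T = A -> B^T = B -> \det (pencil A B) = 0 -> near_SDC A B.
Proof.
move=> symA symB dAB.
have [k [m [e [Q [A1 [CA [NA [B1 [CB [NB]]]]]]]]]] := singular_pencil_form symA symB dAB.
case: n / e A B symA symB dAB Q => A B symA symB _ Q [QA QB Qfree [symA1 symB1] [symNA symNB]].
have Qu : Q \in unitmx by rewrite -row_free_unit.
pose P := invmx Q; have Pu : P \in unitmx by rewrite unitmx_inv.
have unQ (X : 'M[R]_(k + k + (1 + m))) : X = P *m (Q *m X *m Q^T) *m P^T.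
  rewrite /P trmx_inv !mulmxA mulVmx // mul1mx -mulmxA mulmxV ?unitmx_tr //.
  by rewrite mulmx1.
pose D : 'M[R]_m := diag_mx (\row_i - i%:R).
have symD : D^T = D by rewrite tr_diag_mx.
pose C p q (M : 'M[R]_(p, q)) := map_mx polyC M.
have evC p q (M : 'M[R]_(p, q)) t : map_mx (horner_eval t) (C _ _ M) = M.
  by apply/matrixP => i j; rewrite !mxE /horner_eval hornerC.
pose PA := C _ _ P *m singular_form (C _ _ A1) (C _ _ (head_row R k))
  (C _ _ (shift_mx R k)) (C _ _ CA) (pencil (1%:M - NA) NA) *m (C _ _ P)^T.
pose PB := C _ _ P *m singular_form (C _ _ B1) (C _ _ 0)
  (C _ _ (- 1%:M)) (C _ _ CB) (pencil (D - NB) NB) *m (C _ _ P)^T.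
have evform t (M1 L : 'M[R]_k) h (M : 'M[R]_(k, m)) (N N' : 'M[R]_m) :
    ev t (C _ _ P *m singular_form (C _ _ M1) (C _ _ h) (C _ _ L) (C _ _ M) (pencil N N')
            *m (C _ _ P)^T) =
    P *m singular_form M1 h L M (t *: N + N') *m P^T.
  rewrite /ev !map_mxM -map_trmx evC /singular_form !map_block_mx -!map_trmx !evC.
  by rewrite pencil_horner !map_mx0.
have -> : A = ev 0 PA by rewrite evform scale0r add0r -QA -unQ.
have -> : B = ev 0 PB by rewrite evform scale0r add0r -QB -unQ.
have [r r0 generic] := generic_line NA NB.
apply: near_SDC_path; near=> t.
have [|dN sepN] := generic t; first by near: t; exact: poly_neq0_near.
have symNt : (t *: (1%:M - NA) + NA)^T = t *: (1%:M - NA) + NA.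
  by rewrite linearD linearZ linearB /= trmx1 symNA.
have symNt' : (t *: (D - NB) + NB)^T = t *: (D - NB) + NB.
  by rewrite linearD linearZ linearB /= symD symNB.
rewrite !evform; apply: near_SDC_of_generic => //.
exact: realisable_generic.
Unshelve. all: by end_near. Qed.

Lemma singular_det_pencil n (A B : 'M[R]_n) :
  singular_set [set A; B] -> \det (pencil A B) = 0.
Proof.
move=> sing; apply/eqP; apply: contraT => /poly_neq0_near/near0_ex[t].
rewrite det_pencil_horner => dt; exfalso; apply: sing.
exists (t *: A + B); last by rewrite unitmxE unitfE.
exists [:: A; B]; first by move=> M /=; rewrite !inE => /orP[/eqP->|/eqP->]; [left|right].
by rewrite rpredD ?rpredZ ?memv_span ?inE ?eqxx ?orbT.
Qed.

Lemma near_SDC_ASDC n (A B : 'M[R]_n) : near_SDC A B -> ASDC [set A; B].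
Proof.
move=> nAB.
have /choice[F FP] (i : nat) : exists p : 'M[R]_n * 'M[R]_n,
  [/\ p.1^T = p.1, p.2^T = p.2, SDC [set p.1; p.2],
      forall a b, `|A a b - p.1 a b| < i.+1%:R^-1
    & forall a b, `|B a b - p.2 a b| < i.+1%:R^-1].
  have [|A' [B' ?]] := nAB i.+1%:R^-1; first by rewrite invr_gt0.
  by exists (A', B').
have cvg_of (X : 'M[R]_n) (Y : nat -> 'M[R]_n) :
    (forall i a b, `|X a b - Y i a b| < i.+1%:R^-1) -> Y i @[i --> \oo] --> X.
  move=> XY; apply/cvg_ballP => e e0; near=> i; split=> // a b.
  rewrite /ball /= (lt_trans (XY i a b)) //.
  near: i; exact: near_infty_natSinv_lt (PosNum e0).
exists (fun X i => if X == A then (F i).1 else (F i).2); split.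
- move=> X _ i; apply/sym_mxE; have [? ? _ _ _] := FP i; by case: ifP.
- move=> X AB; have [->|XA] := eqVneq X A.
    by apply: cvg_of => i a b; have [_ _ _ + _] := FP i; apply.
  case: AB => [XA'|->]; first by rewrite XA' eqxx in XA.
  by apply: cvg_of => i a b; have [_ _ _ _ +] := FP i; apply.
- move=> i; have [_ _ [P Pu PD] _ _] := FP i; exists P => //.
  by move=> _ [X AB <-]; apply: PD; case: ifP; [left|right].
Unshelve. all: by end_near. Qed.

End Main.

Theorem theorem2 (R : realType) (n : nat) (A B : 'M[R]_n)
    (hAB : [set A; B] `<=` @sym_mx R n) :
  singular_set [set A; B] -> ASDC [set A; B].
Proof.
move=> sing; apply/near_SDC_ASDC/near_SDC_of_singular.
- by apply/sym_mxE/hAB; left.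
- by apply/sym_mxE/hAB; right.
- exact: singular_det_pencil.
Qed.
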